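(* Let $A=(KQ/\mathcal{I},\leqslant)$ be a 1-quasi-hereditary algebra, $j\in Q_0$, and let $M,N$ be $A$-modules with $\operatorname{top}M\cong S(j)$ and $\operatorname{soc}N\cong S(j)$. Then: (1) $M\in\mathfrak{F}(\Delta)$ if and only if $M\cong P(j)/\left(\sum_{i\in\Lambda}P(i)\right)$ for some $\Lambda\subseteq\Lambda^{(j)}\setminus\{j\}$. (2) $N\in\mathfrak{F}(\nabla)$ if and only if $N\cong\left(\bigcap_{i\in\Lambda}\mathcal{K}(i)\right)/\mathcal{K}(j)$ for some $\Lambda\subseteq\Lambda^{(j)}\setminus\{j\}$.
   Context: $K$ is an algebraically closed field, $Q$ is a finite quiver with vertex set $Q_0$, and $KQ/\mathcal{I}$ is a finite-dimensional bound quiver algebra ($\mathcal{I}$ an admissible ideal). Modules are finite-dimensional left modules. For $i\in Q_0$, $S(i)$, $P(i)$, $I(i)$ denote the simple, projective indecomposable and injective indecomposable module at $i$; $[M:S(i)]$ is the Jordan-Hölder multiplicity. Let $\leqslant$ be a partial order on $Q_0$. The standard module $\Delta(i)$ is the largest factor module of $P(i)$ with $[\Delta(i):S(j)]=0$ for all $j\not\leqslant i$; the costandard module $\nabla(i)$ is the largest submodule of $I(i)$ with $[\nabla(i):S(j)]=0$ for all $j\not\leqslant i$. $\mathfrak{F}(\Delta)$ (resp. $\mathfrak{F}(\nabla)$) is the full subcategory of modules having a filtration with all subquotients isomorphic to standard (resp. costandard) modules; $(M:\Delta(i))$ is the (well-defined) number of subquotients isomorphic to $\Delta(i)$. $(KQ/\mathcal{I},\leqslant)$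 is quasi-hereditary if for all $i,j\in Q_0$: $[\Delta(i):S(i)]=1$, and $P(i)\in\mathfrak{F}(\Delta)$ with $(P(i):\Delta(j))=0$ for $j\not\geqslant i$ and $(P(i):\Delta(i))=1$. A quasi-hereditary algebra $A=(KQ/\mathcal{I},\leqslant)$ is 1-quasi-hereditary if for all $i,j\in Q_0=\{1,\ldots,n\}$: (1) there is a smallest and a largest element with respect to $\leqslant$, denoted $1$ and $n$ respectively; (2) $[\Delta(i):S(j)]=(P(j):\Delta(i))=1$ for $j\leqslant i$; (3) $\operatorname{soc}P(j)\cong\operatorname{top}I(j)\cong S(1)$; (4) there are an injection $\Delta(i)\hookrightarrow\Delta(n)$ and a surjection $\nabla(n)\twoheadrightarrow\nabla(i)$. $\Lambda^{(j)}=\{i\in Q_0\mid i\geqslant j\}$. For $i\in\Lambda^{(j)}$ there is a unique submodule of $P(j)$ isomorphic to $P(i)$, and $P(i)$ is regarded as this submodule. One has $P(1)\cong I(1)$, and $\mathcal{K}(j)$ denotes the kernel of the surjection $P(1)\cong I(1)\twoheadrightarrow I(j)$ (it does not depend on the surjection); $\mathcal{K}(j)\subseteq\mathcal{K}(i)$ iff $i\in\Lambda^{(j)}$. The empty sum is $0$ and the empty intersection is $P(1)$. *)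

(* Defs.v *)
From HB Require Import structures.
From mathcomp Require Import all_boot all_order all_algebra all_field.
From mathcomp Require Import finmap boolp.
From mathcomp.multinomials Require Import monalg.

Set Implicit Arguments.
Unset Strict Implicit.
Unset Printing Implicit Defensive.

Import GRing.Theory.
Local Open Scope ring_scope.

(* "The" element of T satisfying P, with default x0 if there is none. *)
Definition the (T : Type) (x0 : T) (P : T -> Prop) : T :=
  if pselect (exists x, P x) is left h then projT1 (cid h) else x0.

Lemma the_spec (T : Type) (x0 : T) (P : T -> Prop) :
  (exists x, P x) -> P (the x0 P).
Proof. by rewrite /the; case: pselect => // h _; case: cid. Qed.

Record quiver (V : finType) := Quiver {
  arrow : finType;
  source : arrow -> V;
  target : arrow -> V }.

Section Paths.
Variables (V : finType) (Q : quiver V).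
Implicit Types (i : V) (s : seq (arrow Q)).

Definition walk_end i s : V := last i [seq target a | a <- s].

Fixpoint is_walk i s : bool :=
  if s is a :: s' then (source a == i) && is_walk (target a) s' else true.

(* A path is its starting vertex together with the list of its arrows, in the
   order in which they are traversed; the trivial path e_i is (i, [::]). *)
Record qpath := QPath {
  qpath_val :> V * seq (arrow Q);
  _ : is_walk qpath_val.1 qpath_val.2 }.

HB.instance Definition _ := [isSub for qpath_val].
HB.instance Definition _ := [Choice of qpath by <:].

Definition path_source (p : qpath) : V := (val p).1.
Definition path_target (p : qpath) : V := walk_end (val p).1 (val p).2.
Definition path_length (p : qpath) : nat := size (val p).2.

Definition trivial_path i : qpath := @QPath (i, [::]) isT.

(* p after q, when q ends where p starts. *)
Definition path_comp (p q : qpath) : option qpath :=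
  if path_target q == path_source p
  then insub ((val q).1, (val q).2 ++ (val p).2) else None.

Lemma is_walk_cat i s1 s2 :
  is_walk i (s1 ++ s2) = is_walk i s1 && is_walk (walk_end i s1) s2.
Proof. by elim: s1 i => //= a s IHs i; rewrite IHs andbA. Qed.

Lemma path_compE (p q : qpath) : path_target q = path_source p ->
  exists2 r, path_comp p q = Some r
    & val r = (path_source q, (val q).2 ++ (val p).2).
Proof.
move=> Epq; rewrite /path_comp Epq eqxx.
have W : is_walk (val q).1 ((val q).2 ++ (val p).2).
  rewrite is_walk_cat; apply/andP; split; first exact: (valP q).
  by move: Epq; rewrite /path_target => ->; exact: (valP p).
by exists (QPath (qpath_val := (_, _)) W); rewrite // insubT.
Qed.

End Paths.

(* Finitely supported functions from the paths of Q to K. *)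
Notation path_algebra K Q := {malg K[qpath Q]}.

Section PathAlgebra.
Variables (K : fieldType) (V : finType) (Q : quiver V).
Local Notation KQ := (path_algebra K Q).

Definition pa_path (p : qpath Q) : KQ := << p >>.

(* Paths compose like functions, so that left KQ-modules are the (covariant)
   representations of Q. *)
Definition pa_mul (x y : KQ) : KQ :=
  \sum_(p <- msupp x) \sum_(q <- msupp y)
    if path_comp p q is Some r then << x@_p * y@_q *g r >> else 0.

Lemma pa_mul_path (p q : qpath Q) :
  pa_mul (pa_path p) (pa_path q)
  = if path_comp p q is Some r then pa_path r else 0.
Proof.
rewrite /pa_mul /pa_path !msuppU oner_eq0 !big_seq_fset1 !mcoeffUU mulr1.
by case: path_comp.
Qed.

Definition pa_one : KQ := \sum_(i : V) pa_path (trivial_path Q i).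

Definition two_sided_ideal (I : KQ -> Prop) : Prop :=
  [/\ I 0, (forall x y, I x -> I y -> I (x + y)),
      (forall c x, I x -> I (c *: x)),
      (forall x y, I y -> I (pa_mul x y))
    & (forall x y, I x -> I (pa_mul x y))].

(* The m-th power of the arrow ideal: the span of the paths of length >= m. *)
Definition arrow_ideal_power (m : nat) (x : KQ) : Prop :=
  forall p, p \in msupp x -> (m <= path_length p)%N.

Definition admissible (I : KQ -> Prop) : Prop :=
  [/\ two_sided_ideal I,
      (forall x, I x -> arrow_ideal_power 2 x)
    & exists2 m, (2 <= m)%N & forall x, arrow_ideal_power m x -> I x].

End PathAlgebra.

(* The algebra KQ/I, I admissible, given by the surjection KQ ->> KQ/I with
   kernel I (that is, up to the choice of the carrier of the quotient). *)
Record bound_quiver_algebra (K : closedFieldType) (V : finType) (Q : quiver V) :=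
  BoundQuiverAlgebra {
    bqa_algebra :> falgType K;
    bqa_ideal : path_algebra K Q -> Prop;
    bqa_admissible : admissible bqa_ideal;
    bqa_proj : {linear path_algebra K Q -> bqa_algebra};
    bqa_proj1 : bqa_proj (pa_one K Q) = 1;
    bqa_projM : forall x y, bqa_proj (pa_mul x y) = bqa_proj x * bqa_proj y;
    bqa_proj_surj : forall a, exists x, bqa_proj x = a;
    bqa_proj_ker : forall x, bqa_proj x = 0 <-> bqa_ideal x }.

Record fdmod (K : fieldType) (A : falgType K) := FdMod {
  fdmod_sort :> vectType K;
  act : A -> fdmod_sort -> fdmod_sort;
  act_linearl : forall v, linear (act^~ v);
  act_linearr : forall a, linear (act a);
  act1 : forall v, act 1 v = v;
  actM : forall a b v, act (a * b) v = act a (act b v) }.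

Section Modules.
Variables (K : fieldType) (A : falgType K).
Implicit Types (M N : fdmod A).

Definition is_hom M N (f : 'Hom(M, N)) : Prop :=
  forall a v, f (act a v) = act a (f v).

Definition injective_hom M N (f : 'Hom(M, N)) : Prop :=
  is_hom f /\ lker f = 0%VS.

Definition surjective_hom M N (f : 'Hom(M, N)) : Prop :=
  is_hom f /\ limg f = fullv.

Definition iso M N : Prop :=
  exists f : 'Hom(M, N), injective_hom f /\ surjective_hom f.

Definition stable M (U : {vspace M}) : Prop :=
  forall a v, v \in U -> act a v \in U.

Record submod M := SubMod {
  submod_space :> {vspace M};
  submod_stable : stable submod_space }.

Lemma zero_stable M : stable (0%VS : {vspace M}).
Proof.
move=> a v; rewrite !memv0 => /eqP->; apply/eqP.
by have := act_linearr (f := M) a (-1) 0 0; rewrite scaler0 addr0 scaleN1r addNr.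
Qed.
Definition zero_submod M := SubMod (@zero_stable M).

Lemma act0 M (a : A) : act a (0 : M) = 0.
Proof. by apply/eqP; rewrite -memv0; apply: zero_stable; rewrite memv0. Qed.

Lemma actD M (a : A) (u v : M) : act a (u + v) = act a u + act a v.
Proof. by have := act_linearr a 1 u v; rewrite !scale1r. Qed.

Lemma full_stable M : stable (fullv : {vspace M}).
Proof. by move=> a v _; rewrite memvf. Qed.
Definition full_submod M := SubMod (@full_stable M).

Lemma sum_stable M (T : finType) (L : {set T}) (U : T -> submod M) :
  stable (\sum_(i in L) U i)%VS.
Proof.
move=> a v /memv_sumP[w wU ->].
rewrite (big_morph (act a) (@actD M a) (act0 M a)).
by apply: memv_sumr => i iL; apply: submod_stable; apply: wU.
Qed.
Definition sum_submod M (T : finType) (L : {set T}) (U : T -> submod M) :=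
  SubMod (sum_stable (L := L) (U := U)).

Lemma cap_stable M (T : finType) (L : {set T}) (U : T -> submod M) :
  stable (\bigcap_(i in L) U i)%VS.
Proof.
move=> a v vU; rewrite memvE; apply/subv_bigcapP => i iL; rewrite -memvE.
apply: submod_stable; move: vU; rewrite !memvE => /subv_bigcapP; exact.
Qed.
Definition cap_submod M (T : finType) (L : {set T}) (U : T -> submod M) :=
  SubMod (cap_stable (L := L) (U := U)).

Section SubModule.
Variables (M : fdmod A) (U : submod M).

Definition sub_act (a : A) (x : subvs_of U) : subvs_of U :=
  vsproj U (act a (vsval x)).

Lemma sub_actE a x : vsval (sub_act a x) = act a (vsval x).
Proof. by rewrite vsprojK //; apply/submod_stable/subvsP. Qed.

Lemma sub_act_linearl x : linear (sub_act^~ x).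
Proof.
by move=> c a b; rewrite /sub_act /= (act_linearl (f := M)) linearP.
Qed.
Lemma sub_act_linearr a : linear (sub_act a).
Proof. by move=> c x y; rewrite /sub_act linearP /= act_linearr linearP. Qed.
Lemma sub_act1 x : sub_act 1 x = x.
Proof. by apply: subvs_inj; rewrite sub_actE act1. Qed.
Lemma sub_actM a b x : sub_act (a * b) x = sub_act a (sub_act b x).
Proof. by apply: subvs_inj; rewrite !sub_actE actM. Qed.

Definition sub_mod : fdmod A :=
  FdMod sub_act_linearl sub_act_linearr sub_act1 sub_actM.

End SubModule.

Section QuotientModule.
Variables (M : fdmod A) (U : submod M).

(* M/U is carried by a linear complement of U in M. *)
Definition quo_proj (v : M) : subvs_of (U^C)%VS :=
  vsproj (U^C)%VS (daddv_pi (U^C)%VS U v).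

Lemma quo_proj_linear : linear quo_proj.
Proof. by move=> c u v; rewrite /quo_proj !linearP. Qed.

Lemma quo_projK x : quo_proj (vsval x) = x.
Proof.
by rewrite /quo_proj daddv_pi_id ?vsvalK ?subvsP // capvC capv_compl.
Qed.

Lemma quo_proj_sub v : v - vsval (quo_proj v) \in (U : {vspace M}).
Proof.
rewrite vsprojK ?memv_pi //.
have := @daddv_pi_add _ _ (U^C)%VS U v.
rewrite capvC capv_compl addvC addv_complf memvf => /(_ erefl isT) {1}<-.
by rewrite addrC addKr memv_pi.
Qed.

Lemma quo_proj_eq0 v : v \in (U : {vspace M}) -> quo_proj v = 0.
Proof.
move=> vU; apply: subvs_inj; apply/eqP; rewrite -memv0 -(capv_compl U) memv_cap.
by rewrite subvsP andbT -(rpredDl _ (quo_proj_sub v)) subrK.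
Qed.

Definition quo_act (a : A) (x : subvs_of (U^C)%VS) : subvs_of (U^C)%VS :=
  quo_proj (act a (vsval x)).

Lemma quo_act_proj a v : quo_act a (quo_proj v) = quo_proj (act a v).
Proof.
set u := vsval (quo_proj v).
have /quo_proj_eq0 : act a (v - u) \in (U : {vspace M}).
  by apply: submod_stable; apply: quo_proj_sub.
have -> : v - u = -1 *: u + v by rewrite scaleN1r addrC.
rewrite act_linearr quo_proj_linear scaleN1r addrC => /eqP.
by rewrite subr_eq0 => /eqP.
Qed.

Lemma quo_act_linearl x : linear (quo_act^~ x).
Proof.
by move=> c a b; rewrite /quo_act /= (act_linearl (f := M)) quo_proj_linear.
Qed.
Lemma quo_act_linearr a : linear (quo_act a).
Proof. by move=> c x y; rewrite /quo_act linearP /= act_linearr quo_proj_linear. Qed.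
Lemma quo_act1 x : quo_act 1 x = x.
Proof. by rewrite /quo_act act1 quo_projK. Qed.
Lemma quo_actM a b x : quo_act (a * b) x = quo_act a (quo_act b x).
Proof. by rewrite {3}/quo_act quo_act_proj /quo_act actM. Qed.

Definition quo_mod : fdmod A :=
  FdMod quo_act_linearl quo_act_linearr quo_act1 quo_actM.

End QuotientModule.

Lemma comap_stable M (W U : submod M) :
  stable (linfun vsval @^-1: U : {vspace sub_mod W})%VS.
Proof.
move=> a v; rewrite -!memv_preim !lfunE /= sub_actE; exact: submod_stable.
Qed.
Definition comap_submod M (W U : submod M) : submod (sub_mod W) :=
  SubMod (@comap_stable M W U).

(* W/U, for submodules U <= W of M. *)
Definition section M (W U : submod M) : fdmod A := quo_mod (comap_submod W U).

Definition simple M : Prop :=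
  (fullv : {vspace M}) <> 0%VS
  /\ forall U : submod M, U = 0%VS :> {vspace M} \/ U = fullv :> {vspace M}.

Definition maximal M (U : submod M) : Prop :=
  U <> fullv :> {vspace M}
  /\ forall W : submod M, (U <= W)%VS ->
       W = U :> {vspace M} \/ W = fullv :> {vspace M}.

Definition largest_submod M (P : submod M -> Prop) : submod M :=
  the (zero_submod M) (fun U => P U /\ forall W, P W -> (W <= U)%VS).

Definition smallest_submod M (P : submod M -> Prop) : submod M :=
  the (zero_submod M) (fun U => P U /\ forall W, P W -> (U <= W)%VS).

(* The intersection of the maximal submodules. *)
Definition rad M : submod M :=
  largest_submod (fun U => forall W, maximal W -> (U <= W)%VS).

(* The sum of the simple submodules. *)
Definition socle M : submod M :=
  smallest_submod (fun U => forall W, simple (sub_mod W) -> (W <= U)%VS).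

Definition top M : fdmod A := quo_mod (rad M).
Definition soc M : fdmod A := sub_mod (socle M).

(* 0 <= U_1 <= ... <= U_r = M, given as the list of the U_k *)
Definition filtration M (Us : seq (submod M)) : Prop :=
  path (fun U W : submod M => (U <= W)%VS) (zero_submod M) Us
  /\ last (zero_submod M) Us = fullv :> {vspace M}.

Definition subquotients M (Us : seq (submod M)) : seq (fdmod A) :=
  pairmap (fun U W => section W U) (zero_submod M) Us.

Definition filtration_by (X : fdmod A -> Prop) M (Us : seq (submod M)) : Prop :=
  filtration Us /\ all (fun Y => `[< X Y >]) (subquotients Us).

Definition count_iso M (Us : seq (submod M)) (X : fdmod A) : nat :=
  count (fun Y => `[< iso Y X >]) (subquotients Us).

(* [M : X], for X simple: by the Jordan-Hoelder theorem the choice of the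
   composition series is immaterial. *)
Definition jh_mult M (X : fdmod A) : nat :=
  the 0%N (fun m => exists2 Us : seq (submod M),
                      filtration_by simple Us & count_iso Us X = m).

Lemma reg_linearl (v : A) : linear (fun a : A => a * v).
Proof. by move=> c a b; rewrite mulrDl scalerAl. Qed.
Lemma reg_linearr (a : A) : linear (fun v : A => a * v).
Proof. by move=> c u v; rewrite mulrDr scalerAr. Qed.
Definition reg_mod : fdmod A :=
  @FdMod K A A (fun a v => a * v) reg_linearl reg_linearr
    (@mul1r A) (fun a b v => esym (mulrA a b v)).

Section Idempotent.
Variable e : A.

Lemma left_ideal_stable : stable (limg (amulr e) : {vspace reg_mod}).
Proof.
move=> a _ /memv_imgP[u _ ->]; rewrite lfunE /=.
apply/memv_imgP; exists (a * u); rewrite ?memvf //.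
by rewrite lfunE /= mulrA.
Qed.
Definition left_ideal : submod reg_mod := SubMod left_ideal_stable.

Local Notation eA := (limg (amull e)).
Local Notation DeA := 'Hom(subvs_of eA, K^o).

(* (a . phi)(x) = phi (x a) on Hom_K(eA, K) *)
Definition dual_rmul (a : A) : 'Hom(subvs_of eA, subvs_of eA) :=
  linfun (vsproj eA \o amulr a \o vsval).
Definition dual_act (a : A) (phi : DeA) : DeA := (phi \o dual_rmul a)%VF.

Lemma dual_rmulE a x : vsval (dual_rmul a x) = vsval x * a.
Proof.
rewrite lfunE /= lfunE /= vsprojK //.
have /memv_imgP[u _ ->] := subvsP x.
apply/memv_imgP; exists (u * a); rewrite ?memvf //.
by rewrite !lfunE /= mulrA.
Qed.

Lemma dual_act_linearl phi : linear (dual_act^~ phi).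
Proof.
move=> c a b; apply/lfunP => x; rewrite !(add_lfunE, scale_lfunE, comp_lfunE).
rewrite -linearP /=; congr (phi _); apply: subvs_inj.
by rewrite linearP /= !dual_rmulE mulrDr scalerAr.
Qed.
Lemma dual_act_linearr a : linear (dual_act a).
Proof.
by move=> c phi psi; apply/lfunP => x; rewrite !(add_lfunE, scale_lfunE, comp_lfunE).
Qed.
Lemma dual_act1 phi : dual_act 1 phi = phi.
Proof.
apply/lfunP => x; rewrite comp_lfunE; congr (phi _); apply: subvs_inj.
by rewrite dual_rmulE mulr1.
Qed.
Lemma dual_actM a b phi : dual_act (a * b) phi = dual_act a (dual_act b phi).
Proof.
apply/lfunP => x; rewrite !comp_lfunE; congr (phi _); apply: subvs_inj.
by rewrite !dual_rmulE mulrA.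
Qed.
Definition dual_mod : fdmod A :=
  @FdMod K A DeA dual_act dual_act_linearl dual_act_linearr dual_act1 dual_actM.

End Idempotent.
End Modules.

Section QuasiHereditary.
Variables (K : closedFieldType) (d : Order.disp_t) (Q0 : finPOrderType d).
Variables (Q : quiver Q0) (A : bound_quiver_algebra K Q).
Implicit Types (i j : Q0) (M : fdmod A).

Definition vertex_idem i : A := bqa_proj A (pa_path K (trivial_path Q i)).

(* P(i) = A e_i, I(i) = Hom_K(e_i A, K), S(i) = P(i) / rad P(i) *)
Definition Pmod i : fdmod A := sub_mod (left_ideal (vertex_idem i)).
Definition Imod i : fdmod A := dual_mod (vertex_idem i).
Definition Smod i : fdmod A := top (Pmod i).

Definition standard_kernel i : submod (Pmod i) :=
  smallest_submod (fun U => forall j, ~~ (j <= i)%O ->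
    jh_mult (quo_mod U) (Smod j) = 0%N).
Definition Delta i : fdmod A := quo_mod (standard_kernel i).

Definition costandard_submod i : submod (Imod i) :=
  largest_submod (fun U => forall j, ~~ (j <= i)%O ->
    jh_mult (sub_mod U) (Smod j) = 0%N).
Definition Nabla i : fdmod A := sub_mod (costandard_submod i).

Definition is_Delta M : Prop := exists i, iso M (Delta i).
Definition is_Nabla M : Prop := exists i, iso M (Nabla i).

Definition F_Delta M : Prop := exists Us : seq (submod M), filtration_by is_Delta Us.
Definition F_Nabla M : Prop := exists Us : seq (submod M), filtration_by is_Nabla Us.

(* (M : Delta(i)), for M in F(Delta) *)
Definition Delta_mult M i : nat :=
  the 0%N (fun m => exists2 Us : seq (submod M),
                      filtration_by is_Delta Us & count_iso Us (Delta i) = m).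

Definition quasi_hereditary : Prop :=
  forall i j,
    [/\ jh_mult (Delta i) (Smod i) = 1%N,
        F_Delta (Pmod i),
        ~~ (i <= j)%O -> Delta_mult (Pmod i) j = 0%N
      & Delta_mult (Pmod i) i = 1%N].

(* o and n are the smallest and the largest vertex. *)
Definition one_quasi_hereditary (o n : Q0) : Prop :=
  quasi_hereditary /\
  [/\ forall i, (o <= i <= n)%O,
      forall i j, (j <= i)%O ->
        jh_mult (Delta i) (Smod j) = 1%N /\ Delta_mult (Pmod j) i = 1%N,
      forall j, iso (soc (Pmod j)) (top (Imod j)) /\ iso (top (Imod j)) (Smod o)
    & forall i,
        (exists f : 'Hom(Delta i, Delta n), injective_hom f)
        /\ (exists g : 'Hom(Nabla n, Nabla i), surjective_hom g)].

Definition up_set j : {set Q0} := [set i | (j <= i)%O].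

(* The submodule of P(j) isomorphic to P(i), for j <= i; it is unique when A is
   1-quasi-hereditary. *)
Definition P_in j i : submod (Pmod j) :=
  the (zero_submod (Pmod j)) (fun U => iso (sub_mod U) (Pmod i)).

(* The kernel of P(o) ~ I(o) ->> I(j); it does not depend on the choice of these
   maps when A is 1-quasi-hereditary with smallest vertex o. *)
Definition ker_to_I o j : submod (Pmod o) :=
  the (zero_submod (Pmod o)) (fun U =>
    exists (f : 'Hom(Pmod o, Imod o)) (g : 'Hom(Imod o, Imod j)),
      [/\ injective_hom f, surjective_hom f, surjective_hom g
        & U = lker (g \o f)%VF :> {vspace Pmod o}]).

End QuasiHereditary.

(* Main.v *)
(** Write [M]_k for the part e_k M of a module M.  Socle and top conditions give
P(o) = I(o), and all P(i) embed into P(o); a dimension count in the e_i-parts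
yields P(i) = A e_i P(j) inside P(j) for i >= j.  For an up-closed set G of
vertices above j put U(G) = sum_(i in G) A e_i P(j).  A standard filtration of
P(j) bounds dim U(G)_k from below by the number of l in G with l >= k, and
removing minimal elements m of G one at a time bounds it from above, because
U(G)/U(G - m) is a quotient of Delta(m); so these quotients are isomorphic to
Delta(m).  Conversely, if U(G)/K is isomorphic to Delta(i), then comparing tops
shows that i is minimal in G, and K = U(G - i) follows by comparing dimensions.
Going down a standard filtration of a quotient M of P(j) from M to 0, each
kernel is therefore some U(G).

Part (2) is dual, with V(G) = the largest submodule of P(o) = I(o) without
composition factors S(l), l in G, so that K(j) = V({l | l >= j}).  The dimension
of the parts of nabla(m) comes from the same estimate on P(k), since
nabla(m)_k is dual to (P(k)/U({l | l > m}))_m. *)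
Require Import Defs.
From HB Require Import structures.
From mathcomp Require Import all_boot all_order all_algebra all_field.
From mathcomp Require Import finmap boolp.
From mathcomp.multinomials Require Import monalg.
From mathcomp Require Import zify.

Set Implicit Arguments.
Unset Strict Implicit.
Unset Printing Implicit Defensive.

Import Order.TTheory GRing.Theory.
Local Open Scope ring_scope.

(** * Maps inducing an isomorphism from a subquotient *)

Arguments act : simpl never.

(** Everything is decided by the numbers dim e_k U. They are additive along layers and equal the
    multiplicities of S(k), and a submodule sharing all of them with a larger one equals it, because
    the e_k sum to 1. The starting data are dim e_k Delta(i) = [k <= i], hence dim e_k P(j) = #{l |
    l >= j, l >= k}, which is symmetric in j and k. For k >= j it is #{l | l >= k}, whatever j is;
    so a copy of P(i) in P(j) exhausts every part e_l P(j) with l >= i.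

    Two obstacles shape the counting. A standard filtration of P(j) gives no control over the order
    of its layers; adding U(G) to all its terms makes the order irrelevant, since a layer Delta(i)
    with i in G is generated by its e_i-part and is swallowed. On the dual side no costandard
    filtration is given, and each step from V(G) to V(G - m) is bounded in one direction only; but
    the bounds along a chain from V(Q0) = 0 to V(empty) = P(o) add up exactly to dim e_k P(o), so
    each of them is an equality. *)

HB.instance Definition _ (K : fieldType) (A : falgType K) (M : fdmod A) (a : A) :=
  GRing.isLinear.Build K M M *:%R (act a) (act_linearr (f := M) a).
HB.instance Definition _ (K : fieldType) (A : falgType K) (M : fdmod A)
    (U : submod M) :=
  GRing.isLinear.Build K M (subvs_of (U^C)%VS) *:%R (quo_proj U)
    (@quo_proj_linear K A M U).

Lemma eq_fullv (K : fieldType) (V : vectType K) (U : {vspace V}) :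
  (forall x, x \in U) -> U = fullv.
Proof. by move=> UT; apply/vspaceP => x; rewrite memvf UT. Qed.

Section Modules.
Variables (K : fieldType) (A : falgType K).
Implicit Types (M N X Y : fdmod A).

Lemma submod_eq M (U W : submod M) : U = W :> {vspace M} -> U = W.
Proof.
case: U W => [U hU] [W hW] /= E; case: _ / E hW => hW.
by rewrite (Prop_irrelevance hU hW).
Qed.

Lemma actsum M (I : Type) (r : seq I) (P : pred I) (F : I -> A) (v : M) :
  act (\sum_(i <- r | P i) F i) v = \sum_(i <- r | P i) act (F i) v.
Proof.
pose f : {linear A -> M} := HB.pack (fun a => act a v)
  (GRing.isLinear.Build K A M *:%R (fun a => act a v) (act_linearl (f := M) v)).
exact: (linear_sum f).
Qed.

Lemma act0l M (v : M) : act 0 v = 0.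
Proof. by have := actsum [::] predT (fun _ : nat => 0) v; rewrite !big_nil. Qed.

Lemma actZl M (c : K) (a : A) (v : M) : act (c *: a) v = c *: act a v.
Proof.
by have := act_linearl (f := M) v c a 0; rewrite /= act0l !addr0.
Qed.

Lemma actDl M (a b : A) (v : M) : act (a + b) v = act a v + act b v.
Proof.
by have := act_linearl (f := M) v 1 a b; rewrite /= !scale1r.
Qed.

Definition actf M (a : A) : 'End(M) := linfun (act (f := M) a).
Lemma actfE M a (v : M) : actf M a v = act a v.
Proof. exact: lfunE. Qed.

(** A module map defined on [W] need not extend to a module map on [M], but it always extends
    linearly. Asking for equivariance on [W] only lets every subquotient map live on the ambient
    space. *)
Definition hom_on M N (W : {vspace M}) (f : 'Hom(M, N)) : Prop :=
  forall a v, v \in W -> f (act a v) = act a (f v).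

Lemma is_hom_on M N (W : {vspace M}) (f : 'Hom(M, N)) : is_hom f -> hom_on W f.
Proof. by move=> fh a v _. Qed.

(* [f] induces an isomorphism from [W/U] onto [X]. *)
Definition secmap M (W U : {vspace M}) X (f : 'Hom(M, X)) : Prop :=
  [/\ hom_on W f, (f @: W = fullv)%VS & (W :&: lker f = U)%VS].

Lemma secmap_hom M (W U : {vspace M}) X (f : 'Hom(M, X)) a v :
  secmap W U f -> v \in W -> f (act a v) = act a (f v).
Proof. by case=> fh _ _; apply: fh. Qed.
Arguments secmap_hom {M W U X f a v}.

Lemma secmap_surj M (W U : {vspace M}) X (f : 'Hom(M, X)) x :
  secmap W U f -> exists2 w, w \in W & f w = x.
Proof.
by case=> _ fs _; have := memvf x; rewrite -fs => /memv_imgP[w wW ->]; exists w.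
Qed.

Lemma secmap_ker M (W U : {vspace M}) X (f : 'Hom(M, X)) w :
  secmap W U f -> w \in W -> (f w == 0) = (w \in U).
Proof. by case=> _ _ <- wW; rewrite memv_cap wW memv_ker. Qed.

Lemma secmapP M (W U : {vspace M}) X (f : 'Hom(M, X)) :
  (U <= W)%VS -> hom_on W f ->
  (forall x, exists2 w, w \in W & f w = x) ->
  (forall w, w \in W -> f w = 0 <-> w \in U) -> secmap W U f.
Proof.
move=> sUW fh fs fk; split=> //.
  by apply: eq_fullv => x; have [w wW <-] := fs x; apply: memv_img.
apply/vspaceP => w; rewrite memv_cap memv_ker; apply/andP/idP => [[wW /eqP]|wU].
  by move/(fk w wW).
by have wW := subvP sUW w wU; rewrite wW; split=> //; apply/eqP/(fk w wW).
Qed.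

Lemma secmap_sub M (W U : {vspace M}) X (f : 'Hom(M, X)) :
  secmap W U f -> (U <= W)%VS.
Proof. by case=> _ _ <-; apply: capvSl. Qed.

Lemma isoP M N : iso M N <-> exists f : 'Hom(M, N), secmap fullv 0%VS f.
Proof.
split=> [[f [[fh fi] [_ fs]]]|[f [fh fs fi]]]; exists f.
  by split; [apply: is_hom_on | | rewrite fi capv0].
have fh' : is_hom f by move=> a v; apply: fh; apply: memvf.
by move: fi; rewrite capfv => fi; split; split.
Qed.

(** The carrier of [section] is a complement inside a subspace type. This equivalence replaces it by
    linear maps on [M]; the map [q] of the proof is the canonical projection of [W]. *)
Lemma iso_sectionP M (W U : submod M) X : (U <= W)%VS ->
  iso (section W U) X <-> exists f : 'Hom(M, X), secmap W U f.
Proof.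
move=> sUW; split=> [/isoP[g gP]|[f fP]].
  pose q := quo_proj (comap_submod W U) \o vsproj W.
  have qh a v : v \in (W : {vspace M}) -> q (act a v) = act a (q v : section W U).
    move=> vW; rewrite /q /= [RHS]quo_act_proj; apply: congr1.
    apply: subvs_inj; rewrite /= sub_actE !vsprojK //.
    exact: submod_stable.
  have q0 v : v \in (W : {vspace M}) -> (q v == 0) = (v \in (U : {vspace M})).
    move=> vW; apply/eqP/idP => [qv|vU].
      have := quo_proj_sub (comap_submod W U) (vsproj W v).
      by rewrite -/(q v) [quo_proj _ _]qv subr0 -memv_preim lfunE /= vsprojK.
    by apply: quo_proj_eq0; rewrite /= -memv_preim lfunE /= vsprojK.
  have qE v : linfun q v = q v by exact: lfunE.
  exists (g \o linfun q)%VF; apply: secmapP => // [a v vW|x|w wW].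
  - by rewrite !comp_lfunE !qE qh // (secmap_hom gP) ?memvf.
  - have [y _ <-] := secmap_surj x gP; exists (vsval (vsval y)); first exact: subvsP.
    by rewrite comp_lfunE qE /q /= vsvalK quo_projK.
  - rewrite comp_lfunE qE -q0 //; split=> [/eqP|/eqP->]; last exact: linear0.
    by rewrite (secmap_ker gP) ?memvf // memv0.
pose g := (f \o linfun vsval \o linfun vsval)%VF : 'Hom(section W U, X).
have gE (x : section W U) : g x = f (vsval (vsval x)).
  by rewrite /g !comp_lfunE !lfunE.
have fq (v : sub_mod W) : g (quo_proj (comap_submod W U) v) = f (vsval v).
  rewrite gE; apply/eqP; rewrite eq_sym -subr_eq0 -linearB -linearB /=.
  rewrite (secmap_ker fP) ?(memvB (subvsP _) (subvsP _)) //.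
  by have := quo_proj_sub (comap_submod W U) v; rewrite /= -memv_preim lfunE.
apply/isoP; exists g; apply: secmapP => [|a x _|x|x _]; first exact: sub0v.
- by rewrite [act a x]/(quo_act _ _) fq /= sub_actE (secmap_hom fP) ?subvsP // gE.
- have [w wW <-] := secmap_surj x fP.
  exists (quo_proj (comap_submod W U) (vsproj W w)); rewrite ?memvf // fq.
  by rewrite vsprojK.
rewrite memv0 gE; split=> [/eqP|/eqP->]; last by rewrite !linear0.
rewrite (secmap_ker fP) ?subvsP // => xU; rewrite -(quo_projK x); apply/eqP.
by apply: quo_proj_eq0; rewrite /= -memv_preim lfunE.
Qed.

Lemma iso_subP M (W : submod M) X :
  iso (sub_mod W) X <-> exists f : 'Hom(M, X), secmap W 0%VS f.
Proof.
split=> [/isoP[g gP]|[f fP]].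
  exists (g \o linfun (vsproj W))%VF; apply: secmapP => [|a v vW|x|w wW]; first exact: sub0v.
  - rewrite !comp_lfunE !lfunE /= -(secmap_hom gP) ?memvf //; congr (g _); apply: subvs_inj.
    by rewrite /= sub_actE !vsprojK // submod_stable.
  - have [y _ <-] := secmap_surj x gP; exists (vsval y); first exact: subvsP.
    by rewrite comp_lfunE lfunE /= vsvalK.
  - rewrite comp_lfunE lfunE /= memv0; split=> [/eqP|/eqP->]; last by rewrite !linear0.
    rewrite (secmap_ker gP) ?memvf // memv0 => /eqP/(congr1 vsval).
    by rewrite vsprojK // => ->; rewrite linear0.
apply/isoP; exists (f \o linfun vsval)%VF.
apply: secmapP => [|a x _|x|x _]; first exact: sub0v.
- by rewrite !comp_lfunE !lfunE /= sub_actE (secmap_hom fP) ?subvsP.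
- have [w wW <-] := secmap_surj x fP.
  by exists (vsproj W w); rewrite ?memvf // comp_lfunE lfunE /= vsprojK.
rewrite comp_lfunE lfunE /= memv0; split=> [/eqP|/eqP->]; last by rewrite !linear0.
by rewrite (secmap_ker fP) ?subvsP // memv0.
Qed.

Lemma iso_quoP M (U : submod M) X :
  iso (quo_mod U) X <-> exists f : 'Hom(M, X), secmap fullv U f.
Proof.
split=> [/isoP[g gP]|[f fP]].
  exists (g \o linfun (quo_proj U))%VF.
  apply: secmapP => [|a v vW|x|w wW]; first exact: subvf.
  - by rewrite !comp_lfunE !lfunE /= -(secmap_hom gP) ?memvf // -quo_act_proj.
  - have [y _ <-] := secmap_surj x gP; exists (vsval y); first exact: memvf.
    by rewrite comp_lfunE lfunE /= quo_projK.
  - rewrite comp_lfunE lfunE /=; split=> [/eqP|wU]; last by rewrite quo_proj_eq0 ?linear0.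
    rewrite (secmap_ker gP) ?memvf // memv0 => /eqP q0.
    by have := quo_proj_sub U w; rewrite q0 subr0.
pose g := (f \o linfun vsval)%VF : 'Hom(quo_mod U, X).
have gE (x : quo_mod U) : g x = f (vsval x) by rewrite comp_lfunE lfunE.
have fq (v : M) : g (quo_proj U v) = f v.
  rewrite gE; apply/eqP; rewrite eq_sym -subr_eq0 -linearB /=.
  by rewrite (secmap_ker fP) ?memvf // quo_proj_sub.
apply/isoP; exists g; apply: secmapP => [|a x _|x|x _]; first exact: sub0v.
- by rewrite [act a x]/(quo_act _ _) fq /= (secmap_hom fP) ?memvf // gE.
- have [w wW <-] := secmap_surj x fP.
  by exists (quo_proj U w); rewrite ?memvf // fq.
rewrite memv0 gE; split=> [/eqP|/eqP->]; last by rewrite !linear0.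
rewrite (secmap_ker fP) ?memvf // => xU; rewrite -(quo_projK x); apply/eqP.
exact: quo_proj_eq0.
Qed.

Lemma secmap_id M : secmap (fullv : {vspace M}) 0%VS (\1%VF : 'Hom(M, M)).
Proof.
apply: secmapP => [|a v _|x|x _]; first exact: sub0v.
- by rewrite !id_lfunE.
- by exists x; rewrite ?memvf ?id_lfunE.
- by rewrite id_lfunE memv0; split=> /eqP.
Qed.

Lemma iso_refl M : iso M M.
Proof. by apply/isoP; exists \1%VF; apply: secmap_id. Qed.

Lemma secmap_comp M (W U : {vspace M}) X Y (f : 'Hom(M, X)) (g : 'Hom(X, Y)) :
  secmap W U f -> secmap fullv 0%VS g -> secmap W U (g \o f)%VF.
Proof.
move=> fP gP; apply: secmapP; first exact: secmap_sub fP.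
- by move=> a v vW; rewrite !comp_lfunE (secmap_hom fP) // (secmap_hom gP) ?memvf.
- move=> y; have [x _ <-] := secmap_surj y gP; have [w wW <-] := secmap_surj x fP.
  by exists w; rewrite ?comp_lfunE.
move=> w wW; rewrite comp_lfunE -(secmap_ker fP) //; split=> [/eqP|/eqP->].
  by rewrite (secmap_ker gP) ?memvf // memv0.
exact: linear0.
Qed.

Lemma iso_trans M N X : iso M N -> iso N X -> iso M X.
Proof.
move=> /isoP[f fP] /isoP[g gP]; apply/isoP; exists (g \o f)%VF.
exact: secmap_comp.
Qed.

Lemma iso_sym M N : iso M N -> iso N M.
Proof.
move=> /isoP[f fP].
have fK : lker f == 0%VS by case: fP => _ _; rewrite capfv => ->.
have fV : cancel (f^-1)%VF f.
  by move=> y; apply: limg_lfunVK; case: fP => _ -> _; apply: memvf.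
apply/isoP; exists (f^-1)%VF.
apply: secmapP => [|a v _|x|x _]; first exact: sub0v.
- have fI : injective f by apply/lker0P.
  by apply: fI; rewrite fV (secmap_hom fP) ?memvf ?fV.
- by exists (f x); rewrite ?memvf // lker0_lfunK.
rewrite memv0; split=> [fx|/eqP->]; last exact: linear0.
by rewrite -(fV x) fx linear0.
Qed.

Lemma secmap_unique_iso M (W U : {vspace M}) X Y (f : 'Hom(M, X)) (g : 'Hom(M, Y)) :
  stable W -> secmap W U f -> secmap W U g -> iso X Y.
Proof.
move=> Wst fP gP; pose W' := SubMod Wst.
have Ust : stable U.
  move=> a v vU; have vW := subvP (secmap_sub fP) v vU.
  rewrite -(secmap_ker fP) ?Wst // (secmap_hom fP) //.
  by move: vU; rewrite -(secmap_ker fP) // => /eqP->; rewrite act0.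
pose U' := SubMod Ust; have sUW : (U' <= W')%VS := secmap_sub fP.
apply: (@iso_trans _ (section W' U')).
  by apply: iso_sym; apply/iso_sectionP => //; exists f.
by apply/iso_sectionP => //; exists g.
Qed.

Lemma img_stable M N (W : submod M) (f : 'Hom(M, N)) :
  hom_on W f -> stable (f @: W)%VS.
Proof.
move=> fh a _ /memv_imgP[w wW ->]; rewrite -fh //.
by apply/memv_img/submod_stable.
Qed.
Definition img_submod M N (W : submod M) (f : 'Hom(M, N)) (fh : hom_on W f) :=
  SubMod (img_stable fh).

Lemma preim_stable M N (W : submod N) (f : 'Hom(M, N)) :
  is_hom f -> stable (f @^-1: W)%VS.
Proof.
by move=> fh a v; rewrite -!memv_preim fh; apply: submod_stable.
Qed.
Definition preim_submod M N (W : submod N) (f : 'Hom(M, N)) (fh : is_hom f) :=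
  SubMod (preim_stable (W := W) fh).

(* [f \o p^-1] is a map as required, [p^-1] being a linear section of [p]. *)
Lemma secmap_img M N (W U : {vspace M}) X (f : 'Hom(M, X)) (p : 'Hom(M, N)) :
    hom_on W p -> stable W -> (W :&: lker p <= U)%VS -> secmap W U f ->
  exists g : 'Hom(N, X), secmap (p @: W)%VS (p @: U)%VS g.
Proof.
move=> ph Wst pU fP.
pose s := daddv_pi (W^C)%VS W; pose r := projv W.
have [h hE] : exists h : 'Hom(N, X), {in W, forall w, h (p w) = f w}.
  pose q := (p \o projv W)%VF.
  exists (f \o projv W \o q^-1)%VF => w wW; rewrite !comp_lfunE.
  have qw : q w = p w by rewrite comp_lfunE projv_id.
  have : q (q^-1%VF (p w)) = p w by rewrite limg_lfunVK // -qw memv_img ?memvf.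
  set z := (q^-1)%VF _; rewrite comp_lfunE => /eqP; rewrite -subr_eq0 -linearB /=.
  rewrite -memv_ker => zk; apply/eqP; rewrite -subr_eq0 -linearB /=.
  have zW : projv W z - w \in W by rewrite memvB ?memv_proj.
  by rewrite (secmap_ker fP) // (subvP pU) // memv_cap zW.
exists h; apply: secmapP.
- exact: limgS (secmap_sub fP).
- by move=> a _ /memv_imgP[w wW ->]; rewrite -ph // !hE ?Wst // (secmap_hom fP).
- by move=> x; have [w wW <-] := secmap_surj x fP; exists (p w); rewrite ?memv_img ?hE.
move=> _ /memv_imgP[w wW ->]; rewrite hE //; split=> [/eqP|].
  by rewrite (secmap_ker fP) //; apply: memv_img.
move=> /memv_imgP[u uU pwu]; apply/eqP; rewrite (secmap_ker fP) //.
have uW := subvP (secmap_sub fP) u uU.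
rewrite -(subrK u w) memvD // (subvP pU) // memv_cap memvB // memv_ker.
by rewrite linearB /= pwu subrr.
Qed.

Lemma secmap_preim M N (W U : {vspace N}) X (f : 'Hom(N, X)) (p : 'Hom(M, N)) :
    is_hom p -> (W <= limg p)%VS -> secmap W U f ->
  secmap (p @^-1: W)%VS (p @^-1: U)%VS (f \o p)%VF.
Proof.
move=> ph Wp fP; apply: secmapP.
- exact: lpreimS (secmap_sub fP).
- by move=> a v; rewrite -memv_preim => vW; rewrite !comp_lfunE ph (secmap_hom fP).
- move=> x; have [w wW <-] := secmap_surj x fP.
  have /memv_imgP[v _ vw] := subvP Wp w wW.
  by exists v; rewrite -?memv_preim ?comp_lfunE -vw.
move=> v; rewrite -!memv_preim comp_lfunE => vW.
by rewrite -(secmap_ker fP) //; split=> /eqP.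
Qed.

(** * Extremal submodules, simple sections and chains *)

Lemma largest_submodP M (P : submod M -> Prop) : P (zero_submod M) ->
    (forall U W Z : submod M, P U -> P W -> (U + W = Z)%VS -> P Z) ->
  P (largest_submod P) /\ forall W, P W -> (W <= largest_submod P)%VS.
Proof.
move=> P0 PD; rewrite /largest_submod.
apply: (@the_spec _ _ (fun U => P U /\ forall W, P W -> (W <= U)%VS)).
(* A member of [P] of maximal dimension is the largest one: its sum with any other member is again
   in [P] and cannot be bigger. Without such a member the dimensions would be unbounded. *)
have [U PU Umax] : exists2 U : submod M, P U & forall W : submod M, P W -> (\dim W <= \dim U)%N.
  apply: contrapT => noU.
  have H n : exists2 U : submod M, P U & (n <= \dim U)%N.
    elim: n => [|n [U PU nU]]; first by exists (zero_submod M).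
    apply: contrapT => noU'; apply: noU; exists U => // W PW.
    by rewrite leqNgt; apply/negP => UW; apply: noU'; exists W => //; apply: leq_ltn_trans UW.
  have [U _] := H (dim M).+1; have := dimvS (subvf U); rewrite dimvf => le1.
  by rewrite leqNgt ltnS le1.
exists U; split=> // W PW.
have Zst : stable (U + W)%VS.
  move=> a _ /memv_addP[u uU [w wW ->]]; rewrite actD.
  by rewrite memv_add // submod_stable.
have PZ := PD U W (SubMod Zst) PU PW erefl.
have /eqP-> : (U : {vspace M}) == (U + W)%VS by rewrite eqEdim addvSl (Umax _ PZ).
exact: addvSr.
Qed.

Lemma smallest_submodP M (P : submod M -> Prop) : P (full_submod M) ->
    (forall U W Z : submod M, P U -> P W -> (U :&: W = Z)%VS -> P Z) ->
  P (smallest_submod P) /\ forall W, P W -> (smallest_submod P <= W)%VS.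
Proof.
move=> P0 PD; rewrite /smallest_submod.
apply: (@the_spec _ _ (fun U => P U /\ forall W, P W -> (U <= W)%VS)).
have [n [U PU Umin]] : exists n, exists2 U : submod M,
    P U /\ (\dim U <= n)%N & forall W : submod M, P W -> (n <= \dim W)%N.
  have exn : exists n, `[< exists2 U : submod M, P U & (\dim U <= n)%N >].
    by exists (dim M); apply/asboolP; exists (full_submod M); rewrite //= dimvf.
  case: (ex_minnP exn) => n /asboolP[U PU Un] nmin; exists n, U => // W PW.
  by apply: nmin; apply/asboolP; exists W.
case: PU => PU Un; exists U; split=> // W PW.
have Zst : stable (U :&: W)%VS.
  by move=> a v; rewrite !memv_cap => /andP[vU vW]; rewrite !submod_stable.
have PZ := PD U W (SubMod Zst) PU PW erefl.
have /(_ PZ) := Umin (SubMod Zst) => /= nZ.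
have: (U :&: W)%VS == U.
  by rewrite eqEdim capvSl /=; apply: leq_trans nZ.
by move=> /eqP/capv_idPl.
Qed.

Lemma iso_simple M N : iso M N -> simple M -> simple N.
Proof.
move=> /isoP[f fP] [M0 Ms]; split=> [N0|U].
  apply: M0; apply/eqP; rewrite -subv0; apply/subvP => v _.
  by rewrite -(secmap_ker fP) ?memvf // -memv0 -N0 memvf.
have fh : is_hom f by move=> a v; rewrite (secmap_hom fP) ?memvf.
have fU : (f @: (f @^-1: U))%VS = U by apply: lpreimK; case: fP => _ -> _; rewrite subvf.
case: (Ms (preim_submod U fh)) => /= E; [left|right]; rewrite -fU E.
  by rewrite limg0.
by case: fP.
Qed.

Lemma simple_section M (W U : submod M) : (U <= W)%VS ->
  simple (section W U) <-> U <> W :> {vspace M} /\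
    forall Z : submod M, (U <= Z)%VS -> (Z <= W)%VS ->
      Z = U :> {vspace M} \/ Z = W :> {vspace M}.
Proof.
move=> sUW; have [f fP] : exists f : 'Hom(M, section W U), secmap W U f.
  by apply/iso_sectionP => //; apply: iso_refl.
split=> [[S0 Ss]|[UW Zs]].
  split=> [UW|Z UZ ZW].
    apply: S0; apply/eqP; rewrite -subv0; apply/subvP => x _.
    have [w wW <-] := secmap_surj (X := section W U) x fP.
    by rewrite memv0 (secmap_ker fP) // UW.
  have fh : hom_on Z f by move=> a v vZ; apply: (secmap_hom fP); apply: (subvP ZW).
  case: (Ss (img_submod fh)) => /= E; [left|right]; apply/eqP.
    rewrite eqEsubv UZ andbT; apply/subvP => v vZ.
    by rewrite -(secmap_ker fP) ?(subvP ZW) // -memv0 -E memv_img.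
  rewrite eqEsubv ZW; apply/subvP => w wW; have : f w \in (f @: Z)%VS by rewrite E memvf.
  move=> /memv_imgP[z zZ fwz]; rewrite -(subrK z w) memvD //.
  apply: (subvP UZ); rewrite -(secmap_ker fP) ?linearB /= ?fwz ?subrr //.
  by rewrite memvB // (subvP ZW).
split=> [S0|Z].
  apply: UW; apply/eqP; rewrite eqEsubv sUW; apply/subvP => w wW.
  by rewrite -(secmap_ker fP) // -memv0 -S0 memvf.
have Tst : stable (W :&: (f @^-1: Z))%VS.
  move=> a v; rewrite !memv_cap -!memv_preim => /andP[vW fv].
  by rewrite submod_stable // (secmap_hom fP) // submod_stable.
have UT : (U <= W :&: (f @^-1: Z))%VS.
  apply/subvP => u uU; have uW := subvP sUW u uU; rewrite memv_cap uW -memv_preim.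
  by move: uU; rewrite -(secmap_ker fP) // => /eqP->; rewrite mem0v.
case: (Zs (SubMod Tst) UT (capvSl _ _)) => /= E; [left|right].
  apply/eqP; rewrite -subv0; apply/subvP => x xZ; rewrite memv0.
  have [w wW fwx] := secmap_surj (X := section W U) x fP.
  by rewrite -fwx (secmap_ker fP) // -E memv_cap wW -memv_preim fwx.
apply: eq_fullv => x; have [w wW <-] := secmap_surj (X := section W U) x fP.
by move: wW; rewrite memv_preim -{1}E memv_cap => /andP[].
Qed.

Lemma simple_sub M (W : submod M) : simple (sub_mod W) <->
  W <> 0%VS :> {vspace M} /\ forall Z : submod M, (Z <= W)%VS ->
      Z = 0%VS :> {vspace M} \/ Z = W :> {vspace M}.
Proof.
have WW : iso (section W (zero_submod M)) (sub_mod W).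
  apply/iso_sectionP; first exact: sub0v.
  by apply/iso_subP; apply: iso_refl.
split=> [/(iso_simple (iso_sym WW))|[W0 Ws]].
  move/simple_section => /(_ (sub0v _))[W0 Ws]; split=> [E|Z ZW]; first exact: W0.
  by apply: Ws => //; apply: sub0v.
apply: (iso_simple WW); apply/simple_section; first exact: sub0v.
by split=> [/esym //|Z _]; apply: Ws.
Qed.

Lemma submod_add_stable M (U W : submod M) : stable (U + W)%VS.
Proof.
move=> a _ /memv_addP[u uU [w wW ->]]; rewrite actD.
by rewrite memv_add // submod_stable.
Qed.
Definition add_submod M (U W : submod M) := SubMod (@submod_add_stable M U W).

Lemma exists_min_above M (U : submod M) (P : submod M -> Prop) :
  (exists2 W : submod M, (U <= W)%VS & P W) ->
  exists2 W : submod M, (U <= W)%VS /\ P W &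
    forall Z : submod M, (U <= Z)%VS -> P Z -> (Z <= W)%VS -> Z = W :> {vspace M}.
Proof.
move=> [W0 UW0 PW0].
have exn : exists n, `[< exists2 W : submod M, (U <= W)%VS /\ P W & (\dim W == n) >].
  by exists (\dim W0); apply/asboolP; exists W0.
case: (ex_minnP exn) => n /asboolP[W [UW PW] /eqP Wn] nmin; exists W => // Z UZ PZ ZW.
apply/eqP; rewrite eqEdim ZW Wn; apply: nmin; apply/asboolP; by exists Z.
Qed.

Lemma exists_max_below M (U : submod M) : U <> fullv :> {vspace M} ->
  exists2 W : submod M, (U <= W)%VS & maximal W.
Proof.
move=> Uf.
have exn : exists n, `[< exists2 W : submod M,
    (U <= W)%VS /\ W <> fullv :> {vspace M} & (dim M - \dim W == n)%N >].
  by exists (dim M - \dim U)%N; apply/asboolP; exists U; rewrite ?eqxx; [split|].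
case: (ex_minnP exn) => n /asboolP[W [UW Wf] /eqP Wn] nmin; exists W => //.
split=> // Z WZ; have [Zf|Zf] := pselect (Z = fullv :> {vspace M}); [by right|left].
apply/eqP; rewrite eq_sym eqEdim WZ.
have := nmin (dim M - \dim Z)%N.
case: asboolP => [_ /(_ isT)|[]]; last first.
  by exists Z => //; split=> //; apply: subv_trans UW WZ.
have := dimvS (subvf Z); have := dimvS (subvf W); rewrite dimvf -Wn => h1 h2.
by rewrite leq_sub2lE.
Qed.

(** [filtration_by] fixes the first term to be zero, so it does not pass to the tail of the list.
    Here the first term is a parameter and the last one is free, which makes induction on the list
    possible. *)
Definition chain (P : fdmod A -> Prop) M (U : submod M) (Us : seq (submod M)) :=
  path (fun U W : submod M => (U <= W)%VS) U Us
  /\ all (fun Y => `[< P Y >]) (pairmap (fun U W => section W U) U Us).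

Lemma chain_cons (P : fdmod A -> Prop) M (U W : submod M) Us :
  chain P U (W :: Us) <-> [/\ (U <= W)%VS, P (section W U) & chain P W Us].
Proof.
split=> [[/= /andP[UW p] /andP[/asboolP PW a]]|[UW PW [p a]]]; first by [].
by split=> /=; rewrite ?UW // a andbT; apply/asboolP.
Qed.

Lemma filtration_byE (P : fdmod A -> Prop) M Us :
  filtration_by P Us <-> chain P (zero_submod M) Us /\
    last (zero_submod M) Us = fullv :> {vspace M}.
Proof. by split=> [[[p l] a]|[[p a] l]]; split. Qed.

Lemma composition_series M (U : submod M) : exists2 Us,
  chain (@simple K A) U Us & last U Us = fullv :> {vspace M}.
Proof.
have [n] := ubnP (dim M - \dim U); elim: n U => // n IH U Un.
have [Uf|Uf] := pselect (U = fullv :> {vspace M}); first by exists [::].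
have [|W [UW WU] Wmin] := @exists_min_above M U (fun W => U <> W :> {vspace M}).
  by exists (full_submod M); rewrite ?subvf.
have dUW : (\dim U < \dim W)%N.
  rewrite ltn_neqAle dimvS // andbT; apply/eqP => E; apply: WU; apply/eqP.
  by rewrite eqEdim UW E leqnn.
have [|Us c l] := IH W.
  have := dimvS (subvf W); rewrite dimvf => dW.
  by rewrite -ltnS; apply: leq_trans Un; rewrite ltnS ltn_sub2l //; apply: leq_trans dUW dW.
exists (W :: Us) => //; apply/chain_cons; split=> //.
apply/simple_section => //; split=> // Z UZ ZW.
have [E|E] := pselect (U = Z :> {vspace M}); [by left|right].
exact: Wmin.
Qed.

End Modules.
Arguments secmap_hom {K A M W U X f a v}.

(** * Modules over a bound quiver algebra *)

Section BoundQuiver.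
Variables (K : closedFieldType) (d : Order.disp_t) (Q0 : finPOrderType d).
Variables (Q : quiver Q0) (A : bound_quiver_algebra K Q).
Implicit Types (i j k l m : Q0) (M N X Y : fdmod A).

Local Notation e := (vertex_idem A).
Local Notation rad := Defs.rad.

Lemma pa_pathZ (c : K) (p : qpath Q) :
  << c *g p >> = c *: pa_path K p :> path_algebra K Q.
Proof.
apply/malgP => q; rewrite mcoeffZ /pa_path [X in X = _]mcoeffU [X in _ * X]mcoeffU.
by rewrite mulrnAr mulr1.
Qed.

Definition pth (p : qpath Q) : A := bqa_proj A (pa_path K p).

Lemma pthM p q :
  pth p * pth q = if path_comp p q is Some r then pth r else 0.
Proof.
by rewrite /pth -bqa_projM pa_mul_path; case: path_comp => // ; rewrite linear0.
Qed.

Lemma act_path M (V : {vspace M}) (v : M) :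
  (forall p, act (pth p) v \in V) -> forall a : A, act a v \in V.
Proof.
move=> pV a; have [x <-] := bqa_proj_surj a; rewrite (monalgE x) linear_sum actsum.
apply: rpred_sum => p _.
rewrite pa_pathZ; rewrite linearZ /= actZl; apply/memvZ/pV.
Qed.

Lemma sum_idem : \sum_i e i = 1 :> A.
Proof. by rewrite -(bqa_proj1 A) /pa_one linear_sum. Qed.

Lemma idem_pth i (p : qpath Q) :
  e i * pth p = if path_target p == i then pth p else 0.
Proof.
rewrite [e i]/(pth (trivial_path Q i)) pthM; case: eqP => [Ep|np].
  have [r -> rE] := path_compE (p := trivial_path Q i) Ep; congr pth.
  by apply: val_inj; rewrite rE /= cats0 /path_source -surjective_pairing.
by rewrite /path_comp; case: eqP.
Qed.

Lemma idemM i j : e i * e j = if i == j then e i else 0.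
Proof.
by rewrite [e j]/(pth _) idem_pth [path_target _]/= eq_sym; case: eqP => [->|].
Qed.

(** An admissible ideal only contains combinations of paths of length at least 2. *)
Lemma idem_neq0 i : e i != 0.
Proof.
apply/eqP => /bqa_proj_ker ei; have [_ I2 _] := bqa_admissible A.
have := I2 _ ei (trivial_path Q i).
by rewrite /pa_path msuppU oner_eq0 inE eqxx => /(_ isT).
Qed.

Lemma pth_long : exists n, forall p : qpath Q, (n <= path_length p)%N -> pth p = 0.
Proof.
have [_ _ [n _ In]] := bqa_admissible A; exists n => p np.
apply/bqa_proj_ker/In => q; rewrite /pa_path msuppU oner_eq0 inE => /eqP->.
exact: np.
Qed.

(** * The arrow ideal acting on a module, and Nakayama's lemma *)

Lemma arrow_walk (a : arrow Q) : is_walk (source a, [:: a]).1 (source a, [:: a]).2.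
Proof. by rewrite /= eqxx. Qed.
Definition arrow_path (a : arrow Q) : qpath Q := QPath (arrow_walk a).

(** The arrow split off is the last one traversed; it is the left factor, since paths compose like
    functions. *)
Lemma path_split (p : qpath Q) : (0 < path_length p)%N ->
  exists a q, path_comp (arrow_path a) q = Some p.
Proof.
case: p => [[i s] /= w]; rewrite /path_length /=; case/lastP: s w => // s a w _.
have : is_walk i s && (source a == walk_end i s).
  by move: (w); rewrite -cats1 is_walk_cat /= andbT.
move=> /andP[ws /eqP sa]; exists a, (QPath (qpath_val := (i, s)) ws).
have [|r -> rE] := @path_compE _ _ (arrow_path a) (QPath (qpath_val := (i, s)) ws).
  by rewrite [RHS]sa.
by congr Some; apply: val_inj; rewrite rE /= cats1.
Qed.

Lemma path_comp_length (p q r : qpath Q) :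
  path_comp p q = Some r -> path_length r = (path_length p + path_length q)%N.
Proof.
rewrite /path_comp; case: eqP => // Ep.
have [r' E rE] := path_compE Ep; move: E; rewrite /path_comp Ep eqxx.
by move=> -> [<-]; rewrite /path_length rE /= size_cat addnC.
Qed.

(** A concrete form of the radical. Single arrows suffice: the last arrow of a nontrivial path is a
    left factor of it. *)
Definition jac M : {vspace M} :=
  (\sum_(a : arrow Q) limg (actf M (pth (arrow_path a))))%VS.

Lemma jac_arrow M a (v : M) : act (pth (arrow_path a)) v \in jac M.
Proof.
by rewrite -actfE memvE; apply: (sumv_sup a) => //; rewrite -memvE memv_img ?memvf.
Qed.

(** Modulo [jac M] only the trivial paths act. *)
Lemma act_jac M (a : A) (v : M) :
  act a v \in (\sum_i <[act (e i) v]> + jac M)%VS.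
Proof.
apply: act_path => p; have [p0|] := posnP (path_length p); last first.
  move=> /path_split[b [q E]]; apply: (subvP (addvSr _ _)).
  by have := pthM (arrow_path b) q; rewrite E => <-; rewrite actM jac_arrow.
apply: (subvP (addvSl _ _)); have -> : p = trivial_path Q (path_source p).
  by apply: val_inj; case: p p0 => [[i [|a' s]] w].
exact: (subvP (sumv_sup (path_source p) isT (subvv _)) _ (memv_line _)).
Qed.

Lemma jac_stable M : stable (jac M).
Proof.
move=> a v /memv_sumP[w wJ ->]; rewrite linear_sum rpred_sum //= => b _.
have /memv_imgP[u _ ->] := wJ b isT; rewrite actfE.
have := act_jac a (act (pth (arrow_path b)) u).
move=> /memv_addP[x xE [y yJ ->]]; rewrite memvD //.
apply: (subvP _ _ xE); apply/subv_sumP => i _; rewrite -memvE -actM idem_pth.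
by case: eqP => _; rewrite ?jac_arrow // act0l mem0v.
Qed.
Definition jac_submod M := SubMod (@jac_stable M).

Lemma jac_hom M N (f : 'Hom(M, N)) : is_hom f -> (f @: jac M <= jac N)%VS.
Proof.
move=> fh; rewrite limg_sum; apply/subv_sumP => a _; apply/subvP => x /memv_imgP.
by move=> [y /memv_imgP[v _ ->] ->]; rewrite actfE fh jac_arrow.
Qed.

Lemma nakayama M (W : submod M) : (W + jac M = fullv)%VS -> W = fullv :> {vspace M}.
Proof.
move=> WJ; have [n long] := pth_long.
(* Downward induction on the length of [p]: long paths are zero in [A], and writing [v] as an
   element of [W] plus images of arrows replaces [p] by strictly longer paths. *)
have pW p v : act (pth p) v \in (W : {vspace M}).
  have [k] := ubnP (n - path_length p)%N; elim: k p v => // k IH p v pk.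
  have [/long->|pn] := leqP n (path_length p); first by rewrite act0l mem0v.
  have := memvf v; rewrite -WJ => /memv_addP[w wW [x xJ ->]].
  rewrite actD memvD //; first exact: submod_stable.
  have /memv_sumP[y yJ ->] := xJ; rewrite linear_sum rpred_sum //= => b _.
  have /memv_imgP[u _ ->] := yJ b isT; rewrite actfE -actM pthM.
  case E: path_comp => [r|]; last by rewrite act0l mem0v.
  apply: IH; rewrite (path_comp_length E) [path_length (arrow_path b)]/= addn1.
  by rewrite subnS -ltnS; apply: leq_trans pk; rewrite ltnS prednK // subn_gt0.
by apply: eq_fullv => v; rewrite -(act1 v); apply: act_path.
Qed.

Lemma jac_full M : jac M = fullv -> (fullv : {vspace M}) = 0%VS.
Proof. by move=> J; have := @nakayama M (zero_submod M); rewrite /= add0v => ->. Qed.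

Lemma jac_maximal M (W : submod M) : maximal W -> (jac M <= W)%VS.
Proof.
move=> [Wf Wmax]; case: (Wmax (add_submod W (jac_submod M)) (addvSl _ _)) => /= E.
  by rewrite -E addvSr.
by case: Wf; apply: nakayama.
Qed.

Lemma act_idem_sum M (v : M) : v = \sum_i act (e i) v.
Proof. by rewrite -actsum sum_idem act1. Qed.

Lemma simple_jac M : simple M -> jac M = 0%VS.
Proof. by move=> [M0 Ms]; case: (Ms (jac_submod M)) => //= /jac_full. Qed.

Lemma act_line M j (a : A) (v : M) : act (e j) v = v ->
  act a v \in (<[v]> + jac M)%VS.
Proof.
move=> ev; apply: (subvP _ _ (act_jac a v)); apply: addvS => //.
apply/subv_sumP => i _; rewrite -memvE -{1}ev -actM idemM.
by case: eqP => [->|_]; rewrite ?ev ?memv_line ?act0l ?mem0v.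
Qed.

(** Arrows act as zero on a simple module, so the line through a vector fixed by [e j] is already a
    submodule. *)
Lemma simple_line M j (v : M) : simple M -> act (e j) v = v -> v != 0 ->
  <[v]>%VS = fullv.
Proof.
move=> Ms ev v0; have vst : stable <[v]>%VS.
  move=> a _ /vlineP[c ->]; rewrite linearZ memvZ //=.
  by have := act_line a ev; rewrite simple_jac // addv0.
case: Ms => _ /(_ (SubMod vst))[] //= /eqP.
by rewrite -dimv_eq0 dim_vline (negbTE v0).
Qed.

(** * Generators and tops of the projectives [P(j)] *)

Definition Pgen j : Pmod A j := vsproj _ (e j).

Lemma idem_left_ideal j : e j \in (left_ideal (e j) : {vspace reg_mod A}).
Proof.
by apply/memv_imgP; exists 1; rewrite ?memvf // lfunE /= mul1r.
Qed.

Lemma reg_actE (a v : A) : act (f := reg_mod A) a v = a * v.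
Proof. by []. Qed.

Lemma Pgen_idem j : act (e j) (Pgen j) = Pgen j.
Proof.
by apply: subvs_inj; rewrite sub_actE !vsprojK ?idem_left_ideal // reg_actE idemM eqxx.
Qed.

Lemma left_ideal_idem j (x : Pmod A j) : vsval x * e j = vsval x :> A.
Proof.
have /memv_imgP[u _ ->] := subvsP x; rewrite lfunE /= -mulrA idemM eqxx //.
Qed.

Lemma act_Pgen j (x : Pmod A j) : act (vsval x : A) (Pgen j) = x.
Proof.
apply: subvs_inj; rewrite sub_actE vsprojK ?idem_left_ideal // reg_actE.
exact: left_ideal_idem.
Qed.

(** Half of the identification of Hom(P(j), M) with e_j M: the generator goes to e_j v. *)
Definition Pmap_fun M j (v : M) (x : Pmod A j) : M := act (vsval x : A) v.

Lemma Pmap_linear M j (v : M) : linear (@Pmap_fun M j v).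
Proof. by move=> c x y; rewrite /Pmap_fun linearP /= actDl actZl. Qed.
HB.instance Definition _ M j (v : M) :=
  GRing.isLinear.Build K (Pmod A j) M *:%R (@Pmap_fun M j v) (@Pmap_linear M j v).

Definition Pmap M j (v : M) : 'Hom(Pmod A j, M) := linfun (@Pmap_fun M j v).

Lemma PmapE M j (v : M) x : Pmap j v x = act (vsval x : A) v.
Proof. by rewrite /Pmap lfunE. Qed.

Lemma Pmap_hom M j (v : M) : is_hom (Pmap j v).
Proof. by move=> a x; rewrite !PmapE sub_actE -actM. Qed.

Lemma Pmap_gen M j (v : M) : Pmap j v (Pgen j) = act (e j) v.
Proof. by rewrite PmapE vsprojK // idem_left_ideal. Qed.

Lemma Pgen_neq0 j : Pgen j != 0.
Proof.
apply: contra (idem_neq0 j) => /eqP/(congr1 vsval); rewrite vsprojK ?idem_left_ideal //.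
by move=> ->.
Qed.

Lemma Pmod_line j : (<[Pgen j]> + jac (Pmod A j) = fullv)%VS.
Proof.
by apply: eq_fullv => x; rewrite -(act_Pgen x); apply/act_line/Pgen_idem.
Qed.

Lemma Pgen_jac j : Pgen j \notin jac (Pmod A j).
Proof.
apply/negP => gJ; have /jac_full f0 : jac (Pmod A j) = fullv.
  by rewrite -(Pmod_line j); apply/esym/addv_idPr; rewrite -memvE.
have := memvf (Pgen j); rewrite f0 memv0.
by apply/negP/Pgen_neq0.
Qed.

(** [P(j)] is local. A maximal submodule above [W] contains [jac]; an element of it with a nonzero
    coefficient at the generator would put the generator itself, hence everything, into it. *)
Lemma Pmod_proper j (W : submod (Pmod A j)) :
  W <> fullv :> {vspace _} -> (W <= jac (Pmod A j))%VS.
Proof.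
move=> Wf; have [Z WZ Zmax] := exists_max_below Wf; apply: subv_trans WZ _.
apply/subvP => z zZ; have := memvf z; rewrite -Pmod_line.
move=> /memv_addP[_ /vlineP[c ->] [y yJ E]].
have yZ := subvP (jac_maximal Zmax) y yJ.
have [c0|c0] := eqVneq c 0; first by rewrite E c0 scale0r add0r.
case: Zmax => Zf _; case: Zf; apply: eq_fullv => x; rewrite -(act_Pgen x).
apply: submod_stable; have : c *: Pgen j \in (Z : {vspace _}).
  by rewrite -(addrK y (c *: Pgen j)) -E memvB.
by move=> /(memvZ c^-1); rewrite scalerA mulVf // scale1r.
Qed.

Lemma jac_Pmod_maximal j : maximal (jac_submod (Pmod A j)).
Proof.
split=> /= [Jf|W JW]; first by have := Pgen_jac j; rewrite Jf memvf.
have [Wf|Wf] := pselect (W = fullv :> {vspace _}); [by right|left].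
by apply/eqP; rewrite eqEsubv JW (Pmod_proper Wf).
Qed.

Lemma radP M : (forall W : submod M, maximal W -> (rad M <= W)%VS) /\
  forall U : submod M, (forall W, maximal W -> (U <= W)%VS) -> (U <= rad M)%VS.
Proof.
apply: (largest_submodP (P := fun U => forall W, maximal W -> (U <= W)%VS)) => [W _|U W Z UP WP UW V Vm].
  exact: sub0v.
by rewrite -UW subv_add UP // WP.
Qed.

Lemma rad_Pmod j : rad (Pmod A j) = jac_submod (Pmod A j).
Proof.
have [rm rl] := radP (Pmod A j); apply/submod_eq/eqP; rewrite eqEsubv.
apply/andP; split; first exact/rm/jac_Pmod_maximal.
by apply: rl => W; apply: jac_maximal.
Qed.

Lemma quo_simple M (W : submod M) : maximal W -> simple (quo_mod W).
Proof.
move=> [Wf Wmax]; have WE : iso (section (full_submod M) W) (quo_mod W).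
  by apply/iso_sectionP; [exact: subvf | apply/iso_quoP/iso_refl].
apply: iso_simple WE _; apply/simple_section; first exact: subvf.
by split=> // Z WZ _; apply: Wmax.
Qed.

Lemma Smod_simple j : simple (Smod A j).
Proof. by rewrite /Smod /top rad_Pmod; apply/quo_simple/jac_Pmod_maximal. Qed.

Lemma Pmap_jac_iso M j (v : M) : simple M -> v != 0 -> act (e j) v = v ->
  iso M (Smod A j).
Proof.
move=> Ms v0 ev; apply: iso_sym; rewrite /Smod /top rad_Pmod.
apply/iso_quoP; exists (Pmap j v); apply: secmapP; first exact: subvf.
- by move=> a x _; rewrite Pmap_hom.
- move=> x; have := memvf x; rewrite -(simple_line Ms ev v0) => /vlineP[c ->].
  by exists (c *: Pgen j); rewrite ?memvf // linearZ /= Pmap_gen ev.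
have Jk x : x \in jac (Pmod A j) -> Pmap j v x = 0.
  move=> xJ; apply/eqP; rewrite -memv0 -(simple_jac Ms).
  by apply: (subvP (jac_hom (Pmap_hom (j := j) v))); apply: memv_img.
move=> x _; split; last exact: Jk.
have := memvf x; rewrite -Pmod_line => /memv_addP[_ /vlineP[c ->] [y yJ ->]].
rewrite linearD /= (Jk y yJ) addr0 linearZ /= Pmap_gen ev => /eqP.
by rewrite scaler_eq0 (negbTE v0) orbF => /eqP->; rewrite scale0r add0r.
Qed.

(** * Dimensions of the parts [e_k W] *)

Definition dk k M (W : {vspace M}) : nat := \dim (actf M (e k) @: W)%VS.

Lemma idem_act k M (v : M) : act (e k) (act (e k) v) = act (e k) v.
Proof. by rewrite -actM idemM eqxx. Qed.

Lemma comp_sub k M (W : submod M) : (actf M (e k) @: W <= W)%VS.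
Proof.
by apply/subvP => x /memv_imgP[w wW ->]; rewrite actfE submod_stable.
Qed.

Lemma compP k M (W : submod M) (v : M) :
  (v \in (actf M (e k) @: W)%VS) = (v \in (W : {vspace M})) && (act (e k) v == v).
Proof.
apply/idP/andP => [/memv_imgP[w wW ->]|[vW /eqP ev]].
  by rewrite actfE submod_stable // idem_act.
by apply/memv_imgP; exists v; rewrite ?actfE.
Qed.

Lemma dkS k M (U W : {vspace M}) : (U <= W)%VS -> (dk k U <= dk k W)%N.
Proof. by move=> UW; apply/dimvS/limgS. Qed.

Lemma dk0 k M : dk k (0%VS : {vspace M}) = 0%N.
Proof. by rewrite /dk limg0 dimv0. Qed.

(** The main tool for membership: a dimension count forces e_k W = e_k U, so e_k W lies in [U]. *)
Lemma dk_sub k M (U W : submod M) : (U <= W)%VS -> (dk k W <= dk k U)%N ->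
  forall w, w \in (W : {vspace M}) -> act (e k) w \in (U : {vspace M}).
Proof.
move=> UW dWU w wW; apply: (subvP (comp_sub k U)).
have /eqP-> : (actf M (e k) @: U == actf M (e k) @: W)%VS.
  by rewrite eqEdim limgS.
by rewrite -actfE memv_img.
Qed.

Lemma dk_eq M (U W : submod M) : (U <= W)%VS ->
  (forall k, (dk k W <= dk k U)%N) -> U = W :> {vspace M}.
Proof.
move=> UW dWU; apply/eqP; rewrite eqEsubv UW; apply/subvP => w wW.
by rewrite (act_idem_sum w) rpred_sum // => k _; apply: (dk_sub UW).
Qed.

Lemma dk_eq0 k M (W : submod M) : dk k W = 0%N ->
  forall w, w \in (W : {vspace M}) -> act (e k) w = 0.
Proof.
move=> d0 w wW; apply/eqP; rewrite -memv0.
by rewrite (@dk_sub k _ (zero_submod M) W) ?sub0v // d0.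
Qed.

Lemma dk_eq0P k M (W : submod M) :
  (forall w, w \in (W : {vspace M}) -> act (e k) w = 0) -> dk k W = 0%N.
Proof.
move=> W0; apply/eqP; rewrite /dk dimv_eq0 -subv0; apply/subvP => x /memv_imgP[w wW ->].
by rewrite actfE W0 // mem0v.
Qed.

(** Exactness of taking e_k-parts: rank-nullity for [f] on e_k W, whose kernel is e_k U and whose
    image is e_k X by equivariance. *)
Lemma dk_secmap k M (W U : submod M) X (f : 'Hom(M, X)) :
  secmap W U f -> dk k W = (dk k U + dk k (fullv : {vspace X}))%N.
Proof.
move=> fP; rewrite /dk -(limg_ker_dim f (actf M (e k) @: W)%VS); congr (_ + _)%N.
  congr (\dim _); apply/vspaceP => v; rewrite memv_cap !compP memv_ker.
  apply/andP/andP => [[/andP[vW ev]]|[vU ev]].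
    by rewrite (secmap_ker fP).
  have vW := subvP (secmap_sub fP) v vU.
  by rewrite vW ev (secmap_ker fP) ?vU.
congr (\dim _); case: (fP) => fh <- _; rewrite -!limg_comp; apply: eq_in_limg => v vW.
by rewrite !comp_lfunE !actfE fh.
Qed.

Lemma dk_iso k M N : iso M N -> dk k (fullv : {vspace M}) = dk k (fullv : {vspace N}).
Proof.
by move=> /isoP[f fP]; rewrite (@dk_secmap k _ (full_submod M) (zero_submod M) _ f fP) dk0.
Qed.

Lemma dk_section k M (W U : submod M) : (U <= W)%VS ->
  dk k W = (dk k U + dk k (fullv : {vspace section W U}))%N.
Proof.
move=> UW; have [f fP] : exists f : 'Hom(M, section W U), secmap W U f.
  by apply/iso_sectionP => //; apply: iso_refl.
exact: dk_secmap fP.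
Qed.

Lemma dk_sub_mod k M (W : submod M) : dk k (fullv : {vspace sub_mod W}) = dk k W.
Proof.
have [f fP] : exists f : 'Hom(M, sub_mod W), secmap W 0%VS f.
  by apply/iso_subP; apply: iso_refl.
by rewrite (@dk_secmap k _ W (zero_submod M) _ f fP) dk0.
Qed.

Lemma dk_quo_mod k M (U : submod M) :
  dk k (fullv : {vspace M}) = (dk k U + dk k (fullv : {vspace quo_mod U}))%N.
Proof.
have [f fP] : exists f : 'Hom(M, quo_mod U), secmap fullv U f.
  by apply/iso_quoP; apply: iso_refl.
exact: (@dk_secmap k _ (full_submod M) U _ f fP).
Qed.

Lemma dk_simple k M : simple M -> dk k (fullv : {vspace M}) = `[< iso M (Smod A k) >].
Proof.
suff S1 N : simple N -> dk k (fullv : {vspace N}) != 0%N ->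
    iso N (Smod A k) /\ dk k (fullv : {vspace N}) = 1%N.
  move=> Ms; case: asboolP => [MS|nMS].
    rewrite (dk_iso k MS); have [|_ -> //] := S1 _ (Smod_simple k).
    have [f fP] : exists f : 'Hom(Pmod A k, Smod A k), secmap fullv (rad (Pmod A k)) f.
      by apply/iso_quoP; apply: iso_refl.
    apply: contra (Pgen_jac k) => /eqP d0.
    have -> : jac (Pmod A k) = rad (Pmod A k) by rewrite rad_Pmod.
    rewrite -(secmap_ker fP) ?memvf // -Pgen_idem (secmap_hom fP) ?memvf //.
    by rewrite (@dk_eq0 k _ (full_submod (Smod A k))) ?memvf.
  apply/eqP; apply: contraT => /(S1 _ Ms)[] //.
move=> Ns d0; have [v]: exists v : N, act (e k) v != 0.
  apply: contrapT => H; move: d0; rewrite (@dk_eq0P k _ (full_submod N)) // => w _.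
  by apply/eqP; apply: contraT => w0; case: H; exists w.
set w := act _ v => w0; have ew : act (e k) w = w by rewrite /w idem_act.
split; first exact: (Pmap_jac_iso Ns w0 ew).
by rewrite /dk -(simple_line Ns ew w0) limg_line actfE ew dim_vline w0.
Qed.

Lemma dk_chain k M (P : fdmod A -> Prop) (c : fdmod A -> nat) (U : submod M) Us :
  chain P U Us -> (forall Y, P Y -> dk k (fullv : {vspace Y}) = c Y) ->
  dk k (last U Us) =
    (dk k U + sumn (map c (pairmap (fun U W => section W U) U Us)))%N.
Proof.
move=> + cP; elim: Us U => [|W Us IH] U; first by rewrite addn0.
by move=> /chain_cons[UW PW ch]; rewrite /= (IH W ch) (dk_section k UW) (cP _ PW) addnA.
Qed.

(** Every composition series counts [dk k], by additivity and [dk_simple]; so the series picked by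
    [the] does not matter. *)
Lemma jh_multE M k : jh_mult M (Smod A k) = dk k (fullv : {vspace M}).
Proof.
rewrite /jh_mult; set R := fun m : nat => _.
have H (m : nat) : R m -> m = dk k (fullv : {vspace M}).
  case=> Us /filtration_byE[ch l] <-; rewrite -l.
  rewrite (dk_chain ch (c := fun Y => `[< iso Y (Smod A k) >] : nat)); last first.
    by move=> Y; apply: dk_simple.
  rewrite dk0 add0n /count_iso /subquotients.
  by elim: pairmap => //= Y s ->.
apply: H; apply: the_spec; have [Us ch l] := composition_series (zero_submod M).
by exists (count_iso Us (Smod A k)), Us => //; apply/filtration_byE.
Qed.

(** Projective cover of a module with simple top: some e_j x lies outside [rad M]. A proper image of
    the map given by x would lie in a maximal submodule; this must be [rad M], which is itself
    maximal. *)
Lemma top_gen M j : iso (top M) (Smod A j) ->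
  exists2 f : 'Hom(Pmod A j, M), is_hom f & limg f = fullv.
Proof.
move=> /iso_quoP[g gP]; have [rm rl] := radP M.
have [v vP] : exists v, g v != 0.
  apply: contrapT => H; case: (Smod_simple j) => + _; apply.
  apply/eqP; rewrite -subv0; apply/subvP => x _; have [w _ <-] := secmap_surj x gP.
  by rewrite memv0; apply: contraT => w0; case: H; exists w.
have radm : maximal (rad M).
  have gi : iso (section (full_submod M) (rad M)) (Smod A j).
    by apply/iso_sectionP; [exact: subvf | exists g].
  have /simple_section[|Rf Rmax] := iso_simple (iso_sym gi) (Smod_simple j).
    exact: subvf.
  by split=> // W RW; apply: Rmax => //; apply: subvf.
have [x gx] : exists x, g (act (e j) x) != 0.
  apply: contrapT => H.
  have := dk_simple j (Smod_simple j); rewrite asboolT; last exact: iso_refl.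
  rewrite (@dk_eq0P j _ (full_submod (Smod A j))) // => y _.
  have [w _ <-] := secmap_surj y gP; rewrite -(secmap_hom gP) ?memvf //.
  by apply/eqP; apply: contraT => w0; case: H; exists w.
exists (Pmap j x); first exact: Pmap_hom.
have [//|F] := pselect (limg (Pmap j x) = fullv).
have Fh : hom_on (full_submod (Pmod A j)) (Pmap j x) by apply/is_hom_on/Pmap_hom.
have Ist := img_stable Fh.
have [W IW Wm] := @exists_max_below _ _ _ (SubMod Ist) F.
case: radm => _ /(_ W (rm W Wm)) [E|E]; last by case: Wm.
case/eqP: gx; apply/eqP; rewrite (secmap_ker gP) ?memvf // -E (subvP IW) //=.
by rewrite -Pmap_gen memv_img ?memvf.
Qed.

End BoundQuiver.

(** * Socles and the injective modules I(j) *)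

Section Injective.
Variables (K : closedFieldType) (d : Order.disp_t) (Q0 : finPOrderType d).
Variables (Q : quiver Q0) (A : bound_quiver_algebra K Q).
Implicit Types (i j k l m : Q0) (M N X Y : fdmod A).

Local Notation e := (vertex_idem A).

Lemma socleP M : (forall W : submod M, simple (sub_mod W) -> (W <= socle M)%VS) /\
  forall U : submod M, (forall W, simple (sub_mod W) -> (W <= U)%VS) -> (socle M <= U)%VS.
Proof.
apply: (smallest_submodP (P := fun U => forall W, simple (sub_mod W) -> (W <= U)%VS)).
  by move=> W _; apply: subvf.
by move=> U W Z UP WP UW V Vs; rewrite -UW subv_cap UP // WP.
Qed.

Lemma exists_simple_sub M (Z : submod M) : Z <> 0%VS :> {vspace M} ->
  exists2 W : submod M, (W <= Z)%VS & simple (sub_mod W).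
Proof.
move=> Z0; have [|W [_ [WZ W0]] Wmin] := @exists_min_above _ _ _ (zero_submod M)
    (fun W => (W <= Z)%VS /\ W <> 0%VS :> {vspace M}).
  by exists Z; rewrite ?sub0v.
exists W => //; apply/simple_sub; split=> // V VW.
have [E|E] := pselect (V = 0%VS :> {vspace M}); [by left|right].
by apply: Wmin => //; [exact: sub0v | split=> //; apply: subv_trans VW WZ].
Qed.

Lemma simple_gen M j : simple M -> dk j (fullv : {vspace M}) != 0%N ->
  exists2 v : M, act (e j) v = v & v != 0.
Proof.
move=> Ms dj; have [v]: exists v : M, act (e j) v != 0.
  apply: contrapT => H; move: dj; rewrite (@dk_eq0P _ _ _ _ _ j _ (full_submod M)) // => w _.
  by apply/eqP; apply: contraT => w0; case: H; exists w.
by move=> v0; exists (act (e j) v); rewrite ?idem_act.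
Qed.

(** Every nonzero submodule contains a simple one, and this must be the whole simple socle. So a
    socle vector fixed by [e j] lies in all nonzero submodules. *)
Lemma soc_gen N j : iso (soc N) (Smod A j) -> exists y : N,
  [/\ act (e j) y = y, y != 0
    & forall Z : submod N, Z <> 0%VS :> {vspace N} -> y \in (Z : {vspace N})].
Proof.
move=> sN; have Ss := iso_simple (iso_sym sN) (Smod_simple A j).
have [|v ev v0] := @simple_gen _ j Ss.
  by rewrite (dk_iso j sN) dk_simple ?asboolT //; [exact: iso_refl | apply: Smod_simple].
exists (vsval v); split=> [||Z /exists_simple_sub[W WZ Ws]].
- by rewrite -{2}ev sub_actE.
- by apply: contra v0 => /eqP v0; apply/eqP/subvs_inj; rewrite v0.
have WS := (socleP N).1 W Ws; move/simple_sub: Ws => [W0 _].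
move/simple_sub: Ss => [_ /(_ _ WS)[//|WE]].
by apply: (subvP WZ); rewrite WE subvsP.
Qed.

Definition line_fun (V : vectType K) (y : V) (c : K^o) : V := c *: y.
Lemma line_fun_linear (V : vectType K) (y : V) : linear (line_fun y).
Proof. by move=> a b c; rewrite /line_fun scalerDl scalerA. Qed.
HB.instance Definition _ (V : vectType K) (y : V) :=
  GRing.isLinear.Build K K^o V *:%R (line_fun y) (line_fun_linear y).

Lemma exists_functional (V : vectType K) (y : V) : y != 0 ->
  exists f : 'Hom(V, K^o), f y != 0.
Proof.
move=> y0; pose h : 'Hom(K^o, V) := linfun (line_fun y).
have hE c : h c = c *: y by rewrite lfunE.
have h0 : lker h == 0%VS.
  rewrite -subv0; apply/subvP => c; rewrite memv_ker hE.
  by rewrite scaler_eq0 (negbTE y0) orbF memv0.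
exists (h^-1)%VF; have -> : y = h 1 by rewrite hE scale1r.
by rewrite lker0_lfunK // oner_eq0.
Qed.

(** * The injective [I(m)] and its evaluation functional *)

Lemma idem_right_ideal m : e m \in limg (amull (e m)).
Proof. by apply/memv_imgP; exists 1; rewrite ?memvf // lfunE /= mulr1. Qed.

(** Dual to the generator of P(m): since evaluating a phi gives phi(e_m a), an element is zero as
    soon as this functional vanishes on all its multiples ([Iev_eq0]). *)
Definition Iev_fun m (phi : Imod A m) : K^o :=
  (phi : 'Hom(subvs_of (limg (amull (e m))), K^o)) (vsproj _ (e m)).
Lemma Iev_linear m : linear (@Iev_fun m).
Proof. by move=> c u v; rewrite /Iev_fun add_lfunE scale_lfunE. Qed.
HB.instance Definition _ m :=
  GRing.isLinear.Build K (Imod A m) K^o *:%R (@Iev_fun m) (@Iev_linear m).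

Definition Iev m : 'Hom(Imod A m, K^o) := linfun (@Iev_fun m).

Lemma IevE m (phi : Imod A m) : Iev m phi =
  (phi : 'Hom(subvs_of (limg (amull (e m))), K^o)) (vsproj _ (e m)).
Proof. by rewrite lfunE. Qed.

Lemma Iev_act m (a : A) (phi : Imod A m) : Iev m (act a phi) =
  (phi : 'Hom(subvs_of (limg (amull (e m))), K^o)) (vsproj _ (e m * a)).
Proof.
rewrite IevE [LHS]comp_lfunE; congr (phi _); apply: subvs_inj.
rewrite dual_rmulE !vsprojK ?idem_right_ideal //.
by apply/memv_imgP; exists a; rewrite ?memvf // lfunE.
Qed.

Lemma Iev_idem m (phi : Imod A m) : Iev m (act (e m) phi) = Iev m phi.
Proof. by rewrite Iev_act IevE idemM eqxx. Qed.

Lemma Iev_eq0 m (phi : Imod A m) :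
  (forall a, Iev m (act a phi) = 0) -> phi = 0.
Proof.
move=> H; apply/lfunP => x; rewrite zero_lfunE -(H (vsval x)) Iev_act; congr (phi _).
apply: subvs_inj; have /memv_imgP[u _ E] := subvsP x.
rewrite vsprojK; last by apply/memv_imgP; exists (vsval x); rewrite ?memvf // lfunE.
by rewrite E lfunE /= mulrA idemM eqxx.
Qed.

Section Imap.
Variables (m : Q0) (M : fdmod A) (f : 'Hom(M, K^o)).

(** Dual to [Pmap_fun]: half of the identification of Hom(M, I(m)) with the dual space of e_m M. *)
Definition Imap_ev (v : M) (x : subvs_of (limg (amull (e m)))) : K^o :=
  f (act (vsval x) v).
Lemma Imap_ev_linear v : linear (Imap_ev v).
Proof. by move=> c x y; rewrite /Imap_ev linearP /= actDl actZl linearP. Qed.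
HB.instance Definition _ v :=
  GRing.isLinear.Build K (subvs_of (limg (amull (e m)))) K^o *:%R
    (Imap_ev v) (Imap_ev_linear v).

Definition Imap_fun (v : M) : Imod A m := linfun (Imap_ev v).
Lemma Imap_fun_linear : linear Imap_fun.
Proof.
move=> c u v; apply/lfunP => x; rewrite add_lfunE scale_lfunE !lfunE /= /Imap_ev.
by rewrite linearP linearP.
Qed.
HB.instance Definition _ :=
  GRing.isLinear.Build K M (Imod A m) *:%R Imap_fun Imap_fun_linear.

Definition Imap : 'Hom(M, Imod A m) := linfun Imap_fun.

Lemma Imap_hom : is_hom Imap.
Proof.
move=> a v; rewrite [Imap _]lfunE [Imap v]lfunE /=; apply/lfunP => x.
by rewrite [RHS]comp_lfunE [LHS]lfunE [RHS]lfunE /= /Imap_ev dual_rmulE actM.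
Qed.

Lemma Iev_Imap v : Iev m (Imap v) = f (act (e m) v).
Proof.
by rewrite IevE [Imap v]lfunE /= /Imap_fun lfunE /= /Imap_ev vsprojK ?idem_right_ideal.
Qed.

End Imap.

(** Take a functional not vanishing on the socle vector [y]. The kernel of the induced map to I(j)
    misses [y], hence is zero. *)
Lemma soc_embed N j : iso (soc N) (Smod A j) ->
  exists2 f : 'Hom(N, Imod A j), is_hom f & lker f = 0%VS.
Proof.
move=> /soc_gen[y [ey y0 yZ]]; have [f fy] := exists_functional y0.
exists (Imap j f); first exact: Imap_hom.
have kst : stable (lker (Imap j f)).
  move=> a v; rewrite !memv_ker Imap_hom => /eqP->; by rewrite act0.
apply: contrapT => /(yZ (SubMod kst)) /=; rewrite memv_ker => /eqP I0.
by case/eqP: fy; rewrite -[y in f y]ey -Iev_Imap I0 linear0.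
Qed.

(** The pairing (x, phi) -> ev(x phi) between e_j P(k) and e_k I(j) has no left kernel, so e_j P(k)
    embeds into the dual of e_k I(j). *)
Lemma dk_Imod_ge j k :
  (dk j (fullv : {vspace Pmod A k}) <= dk k (fullv : {vspace Imod A j}))%N.
Proof.
rewrite /dk; set V := (actf (Imod A j) _ @: _)%VS.
pose th1 (x : Pmod A k) (phi : subvs_of V) : K^o :=
  Iev j (act (vsval x : A) (vsval phi)).
have th1L x : linear (th1 x) by move=> c u v; rewrite /th1 !linearP.
pose th1l x : {linear subvs_of V -> K^o} := HB.pack (th1 x)
  (GRing.isLinear.Build K (subvs_of V) K^o *:%R (th1 x) (th1L x)).
pose th (x : Pmod A k) : 'Hom(subvs_of V, K^o) := linfun (th1l x).
have thE x phi : th x phi = th1 x phi by rewrite lfunE.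
have thL : linear th.
  move=> c u v; apply/lfunP => x; rewrite add_lfunE scale_lfunE !thE /th1.
  by rewrite [vsval _]linearP actDl actZl linearP.
pose thl : {linear Pmod A k -> 'Hom(subvs_of V, K^o)} := HB.pack th
  (GRing.isLinear.Build K (Pmod A k) 'Hom(subvs_of V, K^o) *:%R th thL).
pose Th := linfun thl.
have ThE x phi : Th x phi = Iev j (act (vsval x : A) (vsval phi)).
  by rewrite /Th lfunE /= thE.
have <- : dim 'Hom(subvs_of V, K^o) = \dim V by rewrite /dim /= muln1.
rewrite -dimvf -(@limg_dim_eq _ _ _ Th); first exact/dimvS/subvf.
apply/eqP; rewrite -subv0; apply/subvP => x; rewrite memv_cap memv_ker memv0.
move=> /andP[xE /eqP Tx]; apply: contraT => x0; have [f fx] := exists_functional x0.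
(* The element to pair [x] with: evaluation on its image under [x] returns f(e_j x) = f(x), which is
   nonzero. *)
have phiV : Imap j f (Pgen A k) \in V.
  apply/memv_imgP; exists (Imap j f (Pgen A k)); rewrite ?memvf //.
  by rewrite actfE -Imap_hom Pgen_idem.
have := congr1 (fun g : 'Hom(subvs_of V, K^o) => g (vsproj V (Imap j f (Pgen A k)))) Tx.
rewrite ThE vsprojK // zero_lfunE -Imap_hom act_Pgen Iev_Imap.
by move: xE; rewrite (compP _ (full_submod _)) => /andP[_ /eqP->] /eqP; rewrite (negbTE fx).
Qed.

End Injective.

(** * Multiplicities in standard filtrations *)

Section Standard.
Variables (K : closedFieldType) (d : Order.disp_t) (Q0 : finPOrderType d).
Variables (Q : quiver Q0) (A : bound_quiver_algebra K Q).
Implicit Types (i j k l m : Q0) (M N X Y : fdmod A) (G : {set Q0}).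

Local Notation e := (vertex_idem A).
Local Notation P := (Pmod A).
Local Notation dimk k M := (dk k (fullv : {vspace M})).

Lemma quo_mult0 M (U : submod M) j : jh_mult (quo_mod U) (Smod A j) = 0%N <->
  forall v, act (e j) v \in (U : {vspace M}).
Proof.
rewrite jh_multE; have E := dk_quo_mod j U; split=> [q0 v|UM].
  apply: (@dk_sub _ _ _ _ _ j _ U (full_submod M)); rewrite ?subvf ?memvf //.
  by move: E; rewrite q0 addn0 => ->.
have : (dimk j M <= dk j U)%N.
  apply: dimvS; apply/subvP => _ /memv_imgP[v _ ->].
  by rewrite compP actfE UM idem_act eqxx.
by rewrite E -{2}[dk j U]addn0 leq_add2l leqn0 => /eqP.
Qed.

Lemma sub_mult0 M (U : submod M) j : jh_mult (sub_mod U) (Smod A j) = 0%N <->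
  forall v, v \in (U : {vspace M}) -> act (e j) v = 0.
Proof.
by rewrite jh_multE dk_sub_mod; split; [apply: dk_eq0 | apply: dk_eq0P].
Qed.

Lemma standard_kernelP i :
  (forall j, ~~ (j <= i)%O -> forall v, act (e j) v \in (standard_kernel A i : {vspace P i}))
  /\ forall U : submod (P i),
    (forall j, ~~ (j <= i)%O -> forall v, act (e j) v \in (U : {vspace P i})) ->
    (standard_kernel A i <= U)%VS.
Proof.
have [|U W Z UP WP UW j ji|H1 H2] := smallest_submodP (P := fun U : submod (P i) =>
    forall j, ~~ (j <= i)%O -> jh_mult (quo_mod U) (Smod A j) = 0%N).
- by move=> j _; apply/quo_mult0 => v; apply: memvf.
- apply/quo_mult0 => v; rewrite -UW memv_cap.
  by rewrite (proj1 (quo_mult0 _ _) (UP j ji)) (proj1 (quo_mult0 _ _) (WP j ji)).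
split=> [j ji|U Uj]; first by apply/quo_mult0; apply: H1.
by apply: H2 => j ji; apply/quo_mult0; apply: Uj.
Qed.

Lemma costandard_submodP i :
  (forall j, ~~ (j <= i)%O -> forall v, v \in (costandard_submod A i : {vspace Imod A i}) ->
    act (e j) v = 0)
  /\ forall U : submod (Imod A i),
    (forall j, ~~ (j <= i)%O -> forall v, v \in (U : {vspace Imod A i}) -> act (e j) v = 0) ->
    (U <= costandard_submod A i)%VS.
Proof.
have [|U W Z UP WP UW j ji|H1 H2] := largest_submodP (P := fun U : submod (Imod A i) =>
    forall j, ~~ (j <= i)%O -> jh_mult (sub_mod U) (Smod A j) = 0%N).
- by move=> j _; apply/sub_mult0 => v; rewrite memv0 => /eqP->; apply: act0.
- apply/sub_mult0 => v; rewrite -UW => /memv_addP[u uU [w wW ->]]; rewrite actD.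
  by rewrite (proj1 (sub_mult0 _ _) (UP j ji)) // (proj1 (sub_mult0 _ _) (WP j ji)) ?addr0.
split=> [j ji|U Uj]; first by apply/sub_mult0; apply: H1.
by apply: H2 => j ji; apply/sub_mult0; apply: Uj.
Qed.

(* Opaque copies of [Delta] and of the test [iso Y (Delta l)]: comparing
   [Delta i] with [Delta l] by unfolding is hopelessly slow. *)
Fact Delta_sealed : {F : Q0 -> fdmod A | F = Delta A}.
Proof. by exists (Delta A). Qed.
Local Notation D := (sval Delta_sealed).

Fact isD_sealed : {f : fdmod A -> Q0 -> bool | forall Y l, f Y l = `[< iso Y (D l) >]}.
Proof. by exists (fun Y l => `[< iso Y (D l) >]). Qed.
Local Notation isD := (sval isD_sealed).

Lemma isDP Y l : reflect (iso Y (D l)) (isD Y l).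
Proof. by rewrite (svalP isD_sealed); apply: asboolP. Qed.

Lemma DE i : D i = Delta A i.
Proof. by rewrite (svalP Delta_sealed). Qed.

Lemma Delta_proj i : exists f : 'Hom(P i, D i), secmap fullv (standard_kernel A i) f.
Proof. by rewrite DE; apply/iso_quoP; apply: iso_refl. Qed.

Lemma Delta_gen i (x : D i) : exists a y, x = act a (act (e i) y).
Proof.
have [f fP] := Delta_proj i; have [p _ <-] := secmap_surj x fP.
exists (vsval p : A), (f (Pgen A i)).
by rewrite -!(secmap_hom fP) ?memvf // Pgen_idem act_Pgen.
Qed.

(** The generator of Delta(i) is fixed by e_i, so e_l kills it and only the radical part of [y]
    survives. *)
Lemma Delta_jac i l (y : D i) : l != i -> act (e l) y \in jac (D i).
Proof.
move=> li; have [f fP] := Delta_proj i; have [p _ <-] := secmap_surj y fP.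
have := memvf p; rewrite -Pmod_line => /memv_addP[_ /vlineP[c ->] [r rJ ->]].
rewrite -(secmap_hom fP) ?memvf // actD linearZ /= -Pgen_idem -actM idemM.
rewrite (negbTE li) act0l scaler0 add0r.
have fh : is_hom f by move=> a v; rewrite (secmap_hom fP) ?memvf.
apply: (subvP (jac_hom fh)); apply: memv_img.
exact: (@jac_stable _ _ _ _ A (P i) (e l) r rJ).
Qed.

(* The submodule \sum_(l in G) A e_l M. *)
Definition trace_submod M G : submod M :=
  smallest_submod (fun U => forall l, l \in G -> forall v, act (e l) v \in (U : {vspace M})).

Lemma trace_submodP M G :
  (forall l, l \in G -> forall v, act (e l) v \in (trace_submod M G : {vspace M})) /\
  forall U : submod M, (forall l, l \in G -> forall v, act (e l) v \in (U : {vspace M})) ->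
    (trace_submod M G <= U)%VS.
Proof.
apply: (smallest_submodP (P := fun U : submod M =>
   forall l, l \in G -> forall v, act (e l) v \in (U : {vspace M}))).
  by move=> l _ v; apply: memvf.
by move=> U W Z UP WP UW l lG v; rewrite -UW memv_cap UP // WP.
Qed.

Section Multiplicities.
Variables (o n : Q0) (hA : one_quasi_hereditary A o n).

Lemma dk_D i k : dimk k (D i) = (k <= i)%O.
Proof.
have [_ [_ H _ _]] := hA; rewrite DE -jh_multE; case: (boolP (k <= i)%O) => ki.
  by have [-> _] := H i k ki.
apply/quo_mult0; exact: (standard_kernelP i).1.
Qed.

Lemma mult_D i j : Delta_mult (P j) i = (j <= i)%O.
Proof.
have [Hq [_ H _ _]] := hA; case: (boolP (j <= i)%O) => ji.
  by have [_ ->] := H i j ji.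
by have [_ _ -> //] := Hq j i.
Qed.

Lemma F_P i : F_Delta (P i).
Proof. by have [Hq _] := hA; have [_ ? _ _] := Hq i i. Qed.

Lemma Delta_iso_inj i l : iso (D i) (D l) -> i = l.
Proof.
move=> il; apply/eqP; rewrite eq_le.
have := etrans (esym (dk_D i i)) (etrans (dk_iso i il) (dk_D l i)).
have := etrans (esym (dk_D i l)) (etrans (dk_iso l il) (dk_D l l)).
by rewrite !lexx; case: (l <= i)%O => //; case: (i <= l)%O.
Qed.

Definition Dcount (s : seq (fdmod A)) i := count (isD^~ i) s.

Lemma count_isoE M (Us : seq (submod M)) i :
  count_iso Us (Delta A i) = Dcount (subquotients Us) i.
Proof. by apply: eq_count => Y; rewrite (svalP isD_sealed) DE. Qed.

Lemma sum_Dcount1 (F : Q0 -> nat) Y i : iso Y (D i) ->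
  (\sum_l isD Y l * F l)%N = F i.
Proof.
move=> Yi; rewrite (bigD1 i) //= (introT (isDP Y i) Yi) mul1n big1 ?addn0 // => l li.
case: isDP => // Yl; case/eqP: li; apply: Delta_iso_inj.
exact: iso_trans (iso_sym Yl) Yi.
Qed.

Lemma dk_Dchain k M (U : submod M) Us : chain (@is_Delta _ _ _ _ A) U Us ->
  dk k (last U Us) = (dk k U +
    \sum_l Dcount (pairmap (fun U W => section W U) U Us) l * (k <= l)%O)%N.
Proof.
move=> /(dk_chain (k := k) (c := fun Y => (\sum_l isD Y l * (k <= l)%O)%N)).
move=> ->; last first.
  by move=> Y [i]; rewrite -DE => Yi; rewrite (sum_Dcount1 _ Yi) (dk_iso k Yi) dk_D.
congr (_ + _)%N; elim: pairmap => [|Y s IH] /=; first by rewrite big1.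
by rewrite IH -big_split; apply: eq_bigr => l _; rewrite /= mulnDl.
Qed.

(* The matrix of the order relation is unitriangular. *)
Lemma order_sum_inj (c c' : Q0 -> nat) :
  (forall k, (\sum_l c l * (k <= l)%O = \sum_l c' l * (k <= l)%O)%N) -> c =1 c'.
Proof.
move=> E k; have [b] := ubnP #|[set l | (k < l)%O]|; elim: b k => // b IH k kn.
have := E k; rewrite (bigD1 k) //= [RHS](bigD1 k) //= lexx !muln1.
rewrite [X in (_ + X)%N = _](eq_bigr (fun l => (c' l * (k <= l)%O)%N)); first exact: addIn.
move=> l lk; case: (boolP (k <= l)%O) => kl; last by rewrite !muln0.
rewrite IH // -ltnS; apply: leq_trans kn; rewrite ltnS; apply: proper_card.
have kl' : (k < l)%O by rewrite lt_neqAle eq_sym lk.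
apply/properP; split; first by apply/subsetP => x; rewrite !inE; apply: lt_trans.
by exists l; rewrite !inE ?ltxx.
Qed.

(** [Delta_mult] reads its value off one chosen filtration. Any other one computes the same dim e_k
    P(j) for all k, and [order_sum_inj] recovers the counts from these numbers. *)
Lemma Dcount_Pmod j Us l : filtration_by (@is_Delta _ _ _ _ A) (M := P j) Us ->
  Dcount (subquotients Us) l = (j <= l)%O.
Proof.
move=> fU; rewrite -mult_D /Delta_mult.
set R := fun m : nat => _.
have [Vs fV <-] : R (the 0%N R).
  by apply: the_spec; exists (count_iso Us (Delta A l)), Us.
rewrite count_isoE.
move/filtration_byE: fU => [cU lU]; move/filtration_byE: fV => [cV lV].
apply: order_sum_inj => k.
have := dk_Dchain k cU; have := dk_Dchain k cV; rewrite lU lV dk0 !add0n => -> .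
by move=> ->.
Qed.

Lemma dk_Pmod k j : dimk k (P j) = (\sum_(l in up_set j) (k <= l)%O)%N.
Proof.
have [Us fU] := F_P j; have /filtration_byE[cU lU] := fU.
have := dk_Dchain k cU; rewrite lU dk0 add0n => ->.
rewrite [RHS]big_mkcond /=; apply: eq_bigr => l _; rewrite (Dcount_Pmod _ fU) inE.
by case: (j <= l)%O; rewrite ?mul1n ?mul0n.
Qed.

(** All terms of the chain are enlarged by T = [trace_submod M G]. A layer Delta(i) with i in [G]
    then vanishes, being generated by its e_i-part, which comes from T; any other layer contributes
    at most its own dimension. *)
Lemma trace_chain k M G (U : submod M) Us : chain (@is_Delta _ _ _ _ A) U Us ->
  (dk k (add_submod (last U Us) (trace_submod M G)) <=
   dk k (add_submod U (trace_submod M G)) +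
   \sum_(l in ~: G) Dcount (pairmap (fun U W => section W U) U Us) l * (k <= l)%O)%N.
Proof.
set T := trace_submod M G; have [TG _] := trace_submodP M G.
elim: Us U => [|W Us IH] U; first by rewrite leq_addr.
move=> /chain_cons[UW [i UWi] ch]; apply: leq_trans (IH W ch) _.
rewrite [X in (_ <= _ + X)%N](eq_bigr (fun l => (isD (section W U) l * (k <= l)%O +
  Dcount (pairmap (fun U W => section W U) W Us) l * (k <= l)%O)%N)); last first.
  by move=> l _; rewrite -mulnDl.
rewrite big_split addnA leq_add2r /=.
have [f fP] : exists f : 'Hom(M, D i), secmap W U f by apply/iso_sectionP; rewrite ?DE.
rewrite -DE in UWi; case: (boolP (i \in G)) => iG.
  apply: leq_trans (leq_addr _ _); apply: dkS => /=.
  rewrite subv_add addvSr andbT; apply/subvP => w wW.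
  have [a [y fw]] := Delta_gen (f w); have [v vW fv] := secmap_surj y fP.
  have vW' : act a (act (e i) v) \in (W : {vspace M}) by rewrite !submod_stable.
  rewrite -(subrK (act a (act (e i) v)) w) memv_add //.
    rewrite -(secmap_ker fP) ?memvB // linearB /= fw -fv.
    by rewrite !(secmap_hom fP) ?submod_stable // subrr.
  by apply/submod_stable/TG.
have -> : (\sum_(l in ~: G) isD (section W U) l * (k <= l)%O)%N = (k <= i)%O :> nat.
  rewrite -(sum_Dcount1 (fun l => (k <= l)%O : nat) UWi) big_mkcond /=.
  apply: eq_bigr => l _; rewrite inE; case: (boolP (l \in G)) => //= lG.
  case: isDP => // Yl; move: lG iG.
  by rewrite (Delta_iso_inj (iso_trans (iso_sym Yl) UWi)) => ->.
(* The modular law: passing from U to W raises dim e_k(U + T) by at most as much as dim e_k U,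
   because the intersection with e_k T can only grow. *)
have := dk_secmap k fP; rewrite dk_D /dk /= !limgD => dW.
have := dimv_sum_cap (actf M (e k) @: W) (actf M (e k) @: T).
have := dimv_sum_cap (actf M (e k) @: U) (actf M (e k) @: T).
have : (\dim (actf M (e k) @: U :&: actf M (e k) @: T) <=
        \dim (actf M (e k) @: W :&: actf M (e k) @: T))%N.
  by apply/dimvS/capvS => //; apply: limgS.
move: dW; rewrite -/(dk k W) -/(dk k U); lia.
Qed.

Lemma dk_trace k j G : (dimk k (P j) <=
  dk k (trace_submod (P j) G) + \sum_(l in up_set j :\: G) (k <= l)%O)%N.
Proof.
have [Us fU] := F_P j; have /filtration_byE[cU lU] := fU.
have := trace_chain k G cU; rewrite /dk /= lU sumfv add0v => le1.
apply: leq_trans le1 _; rewrite leq_add2l big_mkcond [leqRHS]big_mkcond /=.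
apply: leq_sum => l _; rewrite (Dcount_Pmod l fU) !inE.
by case: (l \in G) => //; case: (j <= l)%O; rewrite ?mul1n ?mul0n.
Qed.

End Multiplicities.

End Standard.

(** * Embeddings between the projectives P(j) *)

Section ProjectiveEmbeddings.
Variables (K : closedFieldType) (d : Order.disp_t) (Q0 : finPOrderType d).
Variables (Q : quiver Q0) (A : bound_quiver_algebra K Q).
Implicit Types (i j k l m : Q0) (M N X Y : fdmod A) (G : {set Q0}).

Local Notation e := (vertex_idem A).
Local Notation D := (sval (Delta_sealed A)).
Local Notation dimk k M := (dk k (fullv : {vspace M})).

(* As for [Delta], opaque copies of the families P, I and Nabla. *)
Fact Pmod_sealed : {F : Q0 -> fdmod A | F = Pmod A}.
Proof. by exists (Pmod A). Qed.
Local Notation P := (sval Pmod_sealed).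

Fact Imod_sealed : {F : Q0 -> fdmod A | F = Imod A}.
Proof. by exists (Imod A). Qed.
Local Notation I := (sval Imod_sealed).

Fact Nabla_sealed : {F : Q0 -> fdmod A | F = Nabla A}.
Proof. by exists (Nabla A). Qed.
Local Notation Nb := (sval Nabla_sealed).

Let PE : P = Pmod A := svalP Pmod_sealed.
Let IE : I = Imod A := svalP Imod_sealed.

Variables (o n : Q0) (hA : one_quasi_hereditary A o n).

(** The universal property of [Pgen], restated for the opaque copy of P. *)
Fact gen_sealed : {g : forall i, P i | forall i, [/\ act (e i) (g i) = g i,
  forall x : P i, exists a, x = act a (g i)
  & forall M (v : M), act (e i) v = v ->
      exists2 h : 'Hom(P i, M), is_hom h & h (g i) = v]}.
Proof.
rewrite PE; exists (Pgen A) => i; split; first exact: Pgen_idem.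
  by move=> x; exists (vsval x : A); rewrite act_Pgen.
by move=> M v ev; exists (Pmap i v); [apply: Pmap_hom | rewrite Pmap_gen].
Qed.
Local Notation gen := (sval gen_sealed).

Lemma gen_idem i : act (e i) (gen i) = gen i.
Proof. by have [] := svalP gen_sealed i. Qed.

Lemma genP i (x : P i) : exists a, x = act a (gen i).
Proof. by have [_ H _] := svalP gen_sealed i; apply: H. Qed.

Lemma gen_map i M (v : M) : act (e i) v = v ->
  exists2 h : 'Hom(P i, M), is_hom h & h (gen i) = v.
Proof. by have [_ _ H] := svalP gen_sealed i; apply: H. Qed.

Lemma top_gen_sealed M j : iso (top M) (Smod A j) ->
  exists2 f : 'Hom(P j, M), is_hom f & limg f = fullv.
Proof. by rewrite PE; apply: top_gen. Qed.

Lemma soc_embed_sealed N j : iso (soc N) (Smod A j) ->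
  exists2 f : 'Hom(N, I j), is_hom f & lker f = 0%VS.
Proof. by rewrite IE; apply: soc_embed. Qed.

Lemma soc_P j : iso (soc (P j)) (Smod A o).
Proof.
by rewrite PE; have [_ [_ _ /(_ j)[H1 H2] _]] := hA; apply: iso_trans H1 H2.
Qed.

Lemma top_I j : iso (top (I j)) (Smod A o).
Proof. by rewrite IE; have [_ [_ _ /(_ j)[H1 H2] _]] := hA. Qed.

Lemma dk_trace_sealed k j G : (dimk k (P j) <=
  dk k (trace_submod (P j) G) + \sum_(l in up_set j :\: G) (k <= l)%O)%N.
Proof. by rewrite PE; apply: (dk_trace hA). Qed.

Lemma Delta_proj_sealed i : exists f : 'Hom(P i, D i),
  [/\ is_hom f, limg f = fullv & forall U : submod (P i),
    (forall k, ~~ (k <= i)%O -> forall v, act (e k) v \in (U : {vspace P i})) ->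
    (lker f <= U)%VS].
Proof.
rewrite PE; have [f fP] := Delta_proj A i; exists f; split.
- by move=> a v; rewrite (secmap_hom fP) ?memvf.
- by case: fP.
have -> : lker f = standard_kernel A i by case: fP => _ _; rewrite capfv.
by have [_] := standard_kernelP A i.
Qed.

(** * Up-closed sets of vertices and embeddings by dimension count *)

Definition upset G : Prop := forall a b, a \in G -> (a <= b)%O -> b \in G.

Lemma exists_minimal G m : m \in G -> exists2 a, a \in G /\ (a <= m)%O &
  forall b, b \in G -> (b <= a)%O -> b = a.
Proof.
move=> mG; pose F x := #|[set y : Q0 | (y <= x)%O]|.
have H0 : (m \in G) && (m <= m)%O by rewrite mG lexx.
case: (@arg_minnP _ m (fun x => (x \in G) && (x <= m)%O) F H0) => a /andP[aG am] amin.
exists a => // b bG ba; apply: contrapT => /eqP ne.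
have := amin b; rewrite bG (le_trans ba am) => /(_ isT); rewrite leqNgt => /negP; apply.
apply/proper_card/properP; split.
  by apply/subsetP => y; rewrite !inE => yb; apply: le_trans yb ba.
by exists a; rewrite !inE ?lexx // -[(a <= b)%O]andTb -ba -eq_le.
Qed.

Lemma exists_maximal G m : m \in G -> exists2 a, a \in G &
  forall b, b \in G -> (a <= b)%O -> b = a.
Proof.
move=> mG; pose F x := #|[set y : Q0 | (x <= y)%O]|.
case: (@arg_minnP _ m (mem G) F mG) => a aG amin.
exists a => // b bG ab; apply: contrapT => /eqP ne.
have := amin b bG; rewrite leqNgt => /negP; apply.
apply/proper_card/properP; split.
  by apply/subsetP => y; rewrite !inE => /(le_trans ab).
by exists a; rewrite !inE ?lexx // -[(b <= a)%O]andbT -ab -eq_le.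
Qed.

Lemma upsetD1 G m : upset G -> (forall b, b \in G -> (b <= m)%O -> b = m) ->
  upset (G :\ m).
Proof.
move=> Gup mmin a b; rewrite !inE => /andP[am aG] ab; rewrite (Gup a b aG ab) andbT.
by apply: contra am => /eqP bm; apply/eqP/mmin; rewrite // -bm.
Qed.

Lemma up_set_upset j : upset (up_set j).
Proof. by move=> a b; rewrite !inE; apply: le_trans. Qed.

Lemma dk_PmodE k j : dimk k (P j) = (\sum_l (j <= l)%O * (k <= l)%O)%N.
Proof.
rewrite PE (dk_Pmod hA) big_mkcond; apply: eq_bigr => l _; rewrite inE.
by case: (j <= l)%O; rewrite ?mul1n ?mul0n.
Qed.

Lemma dk_PmodC k j : dimk k (P j) = dimk j (P k).
Proof. by rewrite !dk_PmodE; apply: eq_bigr => l _; rewrite mulnC. Qed.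

(** Both sides count the l >= i, since these are automatically above j. *)
Lemma dk_Pmod_up i j : (j <= i)%O -> dimk i (P j) = dimk i (P i).
Proof.
move=> ji; rewrite !dk_PmodE; apply: eq_bigr => l _.
by case: (boolP (i <= l)%O) => il; rewrite ?muln0 // (le_trans ji il).
Qed.

Lemma le_o i : (o <= i)%O.
Proof. by have [_ [/(_ i)/andP[]]] := hA. Qed.

Lemma dk_img k M N (f : 'Hom(M, N)) : is_hom f -> lker f = 0%VS ->
  dk k (limg f) = dimk k M.
Proof.
move=> fh f0; have fhf : hom_on (full_submod M) f by apply: is_hom_on.
have [||g gP] := secmap_img fhf _ _ (secmap_id M); first exact: full_stable.
  by rewrite f0 capv0 sub0v.
rewrite limg0 in gP.
by have := @dk_secmap _ _ _ _ _ k _ (img_submod fhf) (zero_submod N) _ g gP; rewrite dk0.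
Qed.

(** The socle of P(o) is S(o), which gives an embedding into I(o); the top of I(o) is S(o), which
    gives a surjection back. Comparing dimensions makes the embedding bijective. *)
Lemma Pmod_Imod : exists f : 'Hom(P o, I o),
  [/\ is_hom f, lker f = 0%VS & limg f = fullv].
Proof.
have [f fh f0] := soc_embed_sealed (soc_P o); exists f; split=> //.
have [g gh gs] := top_gen_sealed (top_I o).
apply/eqP; rewrite eqEdim subvf -gs.
rewrite (@limg_dim_eq _ _ _ f); last by rewrite f0 capv0.
by rewrite -(limg_ker_dim g fullv) leq_addl.
Qed.

Lemma hom_lift M N X (f : 'Hom(M, N)) (g : 'Hom(X, N)) :
    is_hom f -> is_hom g -> lker f = 0%VS -> lker g = 0%VS ->
    (limg f <= limg g)%VS ->
  exists2 h : 'Hom(M, X), is_hom h & lker h = 0%VS.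
Proof.
move=> fh gh f0 g0 fg; have gI : injective g by apply/lker0P/eqP.
have [h hE] : exists h : 'Hom(M, X), forall x, g (h x) = f x.
  exists (g^-1 \o f)%VF => x.
  by rewrite comp_lfunE limg_lfunVK // (subvP fg) ?memv_img ?memvf.
exists h; first by move=> a v; apply: gI; rewrite [RHS]gh !hE fh.
apply/eqP; rewrite -subv0; apply/subvP => v; rewrite memv_ker => /eqP hv.
by rewrite -f0 memv_ker -hE hv linear0.
Qed.

Lemma Pmod_embed_o i : exists2 f : 'Hom(P i, P o), is_hom f & lker f = 0%VS.
Proof.
have [f fh f0] := soc_embed_sealed (soc_P i); have [g [gh g0 gs]] := Pmod_Imod.
by apply: (hom_lift fh gh f0 g0); rewrite gs subvf.
Qed.

Lemma hom_gen_img i M (f : 'Hom(P i, M)) (W : submod M) : is_hom f ->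
  f (gen i) \in (W : {vspace M}) -> (limg f <= W)%VS.
Proof.
move=> fh fg; apply/subvP => _ /memv_imgP[x _ ->]; have [a ->] := genP x; rewrite fh.
exact: submod_stable.
Qed.

Lemma hom_gen_idem i M (f : 'Hom(P i, M)) : is_hom f ->
  act (e i) (f (gen i)) = f (gen i).
Proof. by move=> fh; rewrite -fh gen_idem. Qed.

(* P(i) and P(j) embed into P(o), and they have the same e_i-part as P(o). *)
Lemma Pmod_embed i j : (j <= i)%O ->
  exists2 f : 'Hom(P i, P j), is_hom f & lker f = 0%VS.
Proof.
move=> ji; have [f fh f0] := Pmod_embed_o i; have [g gh g0] := Pmod_embed_o j.
have ghf : hom_on (full_submod (P j)) g by apply: is_hom_on.
apply: (hom_lift fh gh f0 g0).
apply: (hom_gen_img (W := img_submod ghf) fh); rewrite -(hom_gen_idem fh).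
apply: (@dk_sub _ _ _ _ _ i _ (img_submod ghf) (full_submod (P o)) (subvf _) _ _ (memvf _)).
by rewrite /= (dk_img i gh g0) (dk_Pmod_up (le_o i)) (dk_Pmod_up ji).
Qed.

(** A e_i P(j) contains a copy of P(i), whose e_l-part already has the dimension of e_l P(j). *)
Lemma trace_up i l j : (j <= i)%O -> (i <= l)%O -> forall v,
  act (e l) v \in (trace_submod (P j) [set i] : {vspace P j}).
Proof.
move=> ji il v; have [f fh f0] := Pmod_embed ji; have [TP _] := trace_submodP (P j) [set i].
have fT : (limg f <= trace_submod (P j) [set i])%VS.
  by apply: (hom_gen_img fh); rewrite -(hom_gen_idem fh) TP ?set11.
apply: (@dk_sub _ _ _ _ _ l _ _ (full_submod (P j)) (subvf _) _ _ (memvf _)).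
apply: leq_trans (dkS l fT); rewrite (dk_img l fh f0).
by rewrite (dk_Pmod_up il) (dk_Pmod_up (le_trans ji il)).
Qed.

Lemma Pmod_part_sub i j (U : submod (P j)) : (j <= i)%O ->
  (dimk i (P i) <= dk i U)%N -> forall v, act (e i) v \in (U : {vspace P j}).
Proof.
move=> ji dU v; apply: (@dk_sub _ _ _ _ _ i _ _ (full_submod (P j)) (subvf _) _ _ (memvf _)).
by rewrite /= (dk_Pmod_up ji).
Qed.

(** Uniqueness of the copy of P(i): by dimension any copy contains all of e_i P(j), and it is
    generated by a vector of that part. So every copy equals A e_i P(j). *)
Lemma P_inE j i : (j <= i)%O ->
  the (zero_submod (P j)) (fun U => iso (sub_mod U) (P i)) = trace_submod (P j) [set i].
Proof.
move=> ji; have [TP Tmin] := trace_submodP (P j) [set i].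
have U1 U : iso (sub_mod U) (P i) -> U = trace_submod (P j) [set i].
  move=> UP; have dU : dk i U = dimk i (P i) by rewrite -dk_sub_mod (dk_iso i UP).
  have /isoP[g gP] := iso_sym UP.
  apply/submod_eq/eqP; rewrite eqEsubv; apply/andP; split; last first.
    by apply: Tmin => l; rewrite inE => /eqP-> v; apply: Pmod_part_sub; rewrite ?dU.
  have Ug : act (e i) (vsval (g (gen i))) = vsval (g (gen i)).
    by rewrite -sub_actE -[in RHS]gen_idem (secmap_hom gP) ?memvf.
  apply/subvP => u uU; have [x _ gx] := secmap_surj (X := sub_mod U) (vsproj U u) gP.
  have [a xa] := genP x.
  have -> : u = act a (vsval (g (gen i))).
    by rewrite -[LHS](vsprojK uU) -gx xa (secmap_hom gP) ?memvf // -sub_actE.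
  by apply: submod_stable; rewrite -Ug TP ?set11.
have [f fh f0] := Pmod_embed ji.
have fhf : hom_on (full_submod (P i)) f by apply: is_hom_on.
have Uex : exists U : submod (P j), iso (sub_mod U) (P i).
  exists (img_submod fhf); apply/iso_subP => /=.
  have /isoP[q qP] := iso_refl (P i).
  have [||g gP] := secmap_img fhf _ _ qP; first exact: full_stable.
    by rewrite f0 capv0 sub0v.
  by exists g; rewrite limg0 in gP.
by apply: U1; apply: (@the_spec _ _ (fun U => iso (sub_mod U) (P i))).
Qed.

End ProjectiveEmbeddings.

(** * Quotients of P(j) filtered by standard modules *)

Section Layers.
Variables (K : closedFieldType) (d : Order.disp_t) (Q0 : finPOrderType d).
Variables (Q : quiver Q0) (A : bound_quiver_algebra K Q).
Implicit Types (i j k l m : Q0) (M N X Y : fdmod A) (G L : {set Q0}).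

Local Notation e := (vertex_idem A).
Local Notation D := (sval (Delta_sealed A)).
Local Notation P := (sval (Pmod_sealed A)).
Local Notation I := (sval (Imod_sealed A)).
Local Notation Nb := (sval (Nabla_sealed A)).
Local Notation gen := (sval (gen_sealed A)).
Local Notation dimk k M := (dk k (fullv : {vspace M})).
Variables (o n : Q0) (hA : one_quasi_hereditary A o n).

Local Notation tr j G := (trace_submod (P j) G).

Lemma secmap_section M (W U : submod M) : (U <= W)%VS ->
  exists f : 'Hom(M, section W U), secmap W U f.
Proof. by move=> UW; apply/iso_sectionP => //; apply: iso_refl. Qed.

Lemma trace_subset M G G' : G' \subset G ->
  (trace_submod M G' <= trace_submod M G)%VS.
Proof.
move=> /subsetP sG; have [TP _] := trace_submodP M G; have [_ Tm] := trace_submodP M G'.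
by apply: Tm => l lG; apply/TP/sG.
Qed.

(** In the bound [dk_trace] for G = {l | l > m} the only remaining term is l = m, and it vanishes
    for such k. Hence the kernel of P(m) ->> Delta(m) lies in U({l | l > m}). *)
Lemma part_above k m v : ~~ (k <= m)%O ->
  act (e k) v \in (tr m [set l | (m < l)%O] : {vspace P m}).
Proof.
move=> km; apply: (@dk_sub _ _ _ _ _ k _ _ (full_submod (P m)) (subvf _) _ _ (memvf _)).
apply: leq_trans (dk_trace_sealed hA k m [set l | (m < l)%O]) _.
rewrite big1 ?addn0 // => l; rewrite !inE => /andP[ml1 ml2].
have -> : l = m by apply/eqP; move: ml1; rewrite lt_neqAle ml2 andbT negbK eq_sym.
by rewrite (negbTE km).
Qed.

(** The map is P(m) -> P(j) followed by the projection to the layer. It is onto because the copy of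
    P(m) contains e_m P(j). It kills the kernel of P(m) ->> Delta(m), since by [part_above] that
    kernel is generated by parts e_l with l > m, and such l remain in G - m. *)
Lemma layer_map j m G : G \subset up_set j -> upset G -> m \in G ->
  exists h : 'Hom(P m, section (tr j G) (tr j (G :\ m))),
    [/\ is_hom h, limg h = fullv & forall f : 'Hom(P m, D m), is_hom f ->
      (forall U : submod (P m),
        (forall k, ~~ (k <= m)%O -> forall v, act (e k) v \in (U : {vspace P m})) ->
        (lker f <= U)%VS) -> (lker f <= lker h)%VS].
Proof.
move=> Gj Gup mG; have jm : (j <= m)%O by have := subsetP Gj m mG; rewrite inE.
have [f fh f0] := Pmod_embed hA jm.
have UW := trace_subset (P j) (subsetDl G [set m]); have [q qP] := secmap_section UW.
have [TG TGm] := trace_submodP (P j) G; have [TG' _] := trace_submodP (P j) (G :\ m).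
have fG : (limg f <= tr j G)%VS.
  by apply: (hom_gen_img fh); rewrite -(hom_gen_idem fh) TG.
have fhf : hom_on (full_submod (P m)) f by apply: is_hom_on.
have hE x : (q \o f)%VF x = q (f x) by rewrite comp_lfunE.
have hh : is_hom (q \o f)%VF.
  move=> a x; rewrite !hE fh (secmap_hom qP) //.
  by apply: (subvP fG); rewrite memv_img ?memvf.
exists (q \o f)%VF; split=> //.
  apply: eq_fullv => y; have [w wG <-] := secmap_surj y qP.
  have wS : (tr j G <= add_submod (tr j (G :\ m)) (img_submod fhf))%VS.
    apply: TGm => l lG v; have [->|lm] := eqVneq l m.
      apply: (subvP (addvSr _ _)); apply: (Pmod_part_sub hA jm).
      by rewrite /= (dk_img m fh f0).
    by apply: (subvP (addvSl _ _)); rewrite TG' // !inE lm.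
  have /memv_addP[u uG [_ /memv_imgP[x _ ->] ->]] := subvP wS w wG.
  rewrite linearD /= (_ : q u = 0) ?add0r -?hE ?memv_img ?memvf //.
  by apply/eqP; rewrite (secmap_ker qP) // (subvP UW).
move=> g gh gmin.
have -> : lker (q \o f)%VF = preim_submod (tr j (G :\ m)) fh :> {vspace P m}.
  apply/vspaceP => x; rewrite memv_ker hE -memv_preim (secmap_ker qP) //.
  by apply: (subvP fG); rewrite memv_img ?memvf.
apply: gmin => k km v.
have [_ Tmin] := trace_submodP (P m) [set l | (m < l)%O].
apply: (subvP (Tmin (preim_submod (tr j (G :\ m)) fh) _)); last exact: part_above.
move=> l; rewrite inE => ml x; rewrite -memv_preim fh; apply: TG'.
by rewrite !inE (gt_eqF ml) /= (Gup m) // ltW.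
Qed.

Lemma trace_le j k G : G \subset up_set j -> upset G ->
  (dk k (tr j G) <= \sum_(l in G) (k <= l)%O)%N.
Proof.
have [b] := ubnP #|G|; elim: b G => // b IH G Gb Gj Gup.
have [G0|[m0 m0G]] := set_0Vmem G.
  have [_ Tm] := trace_submodP (P j) G.
  have T0 : (tr j G <= zero_submod (P j))%VS by apply: Tm => l; rewrite G0 inE.
  by apply: leq_trans (dkS k T0) _; rewrite dk0.
have [m [mG _] mmin] := exists_minimal m0G.
have G'up := upsetD1 Gup mmin.
have G'j : G :\ m \subset up_set j by apply: subset_trans Gj; apply: subsetDl.
rewrite (big_setD1 m) //= addnC.
have UW := trace_subset (P j) (subsetDl G [set m]); rewrite (dk_section k UW).
apply: leq_add; first by apply: IH => //; move: Gb; rewrite (cardsD1 m) mG ltnS.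
have [h [hh hs hker]] := layer_map Gj Gup mG.
have [f [fh fs fmin]] := Delta_proj_sealed A m.
have kh := hker f fh fmin; rewrite -(dk_D hA m k) /dk -hs -fs -!limg_comp.
have hc : (actf _ (e k) \o h)%VF = (h \o actf _ (e k))%VF.
  by apply/lfunP => x; rewrite !comp_lfunE !actfE hh.
have fc : (actf _ (e k) \o f)%VF = (f \o actf _ (e k))%VF.
  by apply/lfunP => x; rewrite !comp_lfunE !actfE fh.
rewrite hc fc !limg_comp.
have := limg_ker_dim h (limg (actf (P m) (e k))).
have := limg_ker_dim f (limg (actf (P m) (e k))).
have : (\dim (limg (actf (P m) (e k)) :&: lker f) <=
        \dim (limg (actf (P m) (e k)) :&: lker h))%N.
  by apply/dimvS/capvS.
lia.
Qed.

Lemma dk_tr j k G : G \subset up_set j -> upset G ->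
  dk k (tr j G) = (\sum_(l in G) (k <= l)%O)%N.
Proof.
move=> Gj Gup; apply/eqP; rewrite eqn_leq trace_le //=.
have := dk_trace_sealed hA k j G.
have -> : dimk k (P j) = (\sum_(l in up_set j) (k <= l)%O)%N.
  rewrite (dk_PmodE hA) [RHS]big_mkcond; apply: eq_bigr => l _; rewrite inE.
  by case: (j <= l)%O; rewrite ?mul1n ?mul0n.
by rewrite (big_setID G) /= (setIidPr Gj) leq_add2r.
Qed.

(** The layer and Delta(m) are quotients of P(m) with nested kernels; the exact count [dk_tr] for G
    and G - m makes the kernels equal. *)
Lemma layer_Delta j m G : G \subset up_set j -> upset G -> m \in G ->
  upset (G :\ m) -> iso (section (tr j G) (tr j (G :\ m))) (D m).
Proof.
move=> Gj Gup mG G'up; have [h [hh hs hker]] := layer_map Gj Gup mG.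
have [f [fh fs fmin]] := Delta_proj_sealed A m.
have G'j : G :\ m \subset up_set j by apply: subset_trans Gj; apply: subsetDl.
have UW := trace_subset (P j) (subsetDl G [set m]).
have hkst (N : fdmod A) (g : 'Hom(P m, N)) (gh : is_hom g) : stable (lker g).
  by move=> a v; rewrite !memv_ker gh => /eqP->; rewrite act0.
have secg (N : fdmod A) (g : 'Hom(P m, N)) (gh : is_hom g) : limg g = fullv ->
    secmap (fullv : {vspace P m}) (lker g) g.
  by move=> gs; split; [apply: is_hom_on | | rewrite capfv].
have hS := secg _ h hh hs; have fS := secg _ f fh fs.
have E : lker f = lker h.
  apply: (@dk_eq _ _ _ _ _ _ (SubMod (hkst _ f fh)) (SubMod (hkst _ h hh))).
    exact: (hker f fh fmin).
  move=> k.
  have := @dk_secmap _ _ _ _ _ k _ (full_submod (P m)) (SubMod (hkst _ f fh)) _ f fS.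
  have := @dk_secmap _ _ _ _ _ k _ (full_submod (P m)) (SubMod (hkst _ h hh)) _ h hS.
  have := dk_section k UW; rewrite !dk_tr // (big_setD1 m mG) /= (dk_D hA).
  lia.
rewrite E in fS; exact: (secmap_unique_iso (@full_stable _ _ (P m)) hS fS).
Qed.

Lemma layer_inv j i G (U : submod (P j)) : G \subset up_set j -> upset G ->
    (U <= tr j G)%VS -> iso (section (tr j G) U) (D i) ->
  [/\ i \in G, upset (G :\ i) & U = tr j (G :\ i)].
Proof.
move=> Gj Gup UG /(iso_sectionP _ UG)[f fP].
have [TG TGm] := trace_submodP (P j) G.
have Wst : stable (tr j G :&: (f @^-1: jac (D i)))%VS.
  move=> a v; rewrite !memv_cap -!memv_preim => /andP[vG fv].
  by rewrite submod_stable // (secmap_hom fP) // jac_stable.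
(* Otherwise f would send e_m P(j) into the radical for all minimal m of G. By [trace_up] each e_l
   P(j) with l in G is generated from such a part, so Delta(i) would equal its radical. *)
have [m [mG mmin [v fv]]] : exists m, [/\ m \in G,
    forall b, b \in G -> (b <= m)%O -> b = m & exists v, f (act (e m) v) \notin jac (D i)].
  apply: contrapT => H.
  have GW : (tr j G <= SubMod Wst)%VS.
    apply: TGm => l lG v; have [m [mG ml] mmin] := exists_minimal lG.
    have jm : (j <= m)%O by have := subsetP Gj m mG; rewrite inE.
    have [_ Tm] := trace_submodP (P j) [set m].
    apply: (subvP (Tm (SubMod Wst) _)); last exact: (trace_up hA jm ml).
    move=> l'; rewrite inE => /eqP-> u; rewrite memv_cap TG //= -memv_preim.
    by apply: contraT => fu; case: H; exists m; split=> //; exists u.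
  have /jac_full D0 : jac (D i) = fullv.
    apply: eq_fullv => x; have [w wG <-] := secmap_surj x fP.
    by have := subvP GW w wG; rewrite memv_cap -memv_preim => /andP[].
  by have := dk_D hA i i; rewrite D0 dk0 lexx.
have mi : m = i.
  apply/eqP; apply: contraNT fv => mi; rewrite -idem_act (secmap_hom fP) ?TG //.
  exact: Delta_jac.
subst m; have G'up := upsetD1 Gup mmin; split=> //.
have G'j : G :\ i \subset up_set j by apply: subset_trans Gj; apply: subsetDl.
have [_ Tm] := trace_submodP (P j) (G :\ i).
(* For l in G - i minimality of i gives l not <= i, so e_l kills Delta(i). *)
have TU : (tr j (G :\ i) <= U)%VS.
  apply: Tm => l; rewrite !inE => /andP[li lG] u.
  rewrite -(secmap_ker fP) ?TG // -idem_act (secmap_hom fP) ?TG //.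
  apply/eqP; apply: (@dk_eq0 _ _ _ _ _ l _ (full_submod (D i))); rewrite ?memvf //=.
  rewrite (dk_D hA); case: (boolP (l <= i)%O) => // le_li.
  by case/eqP: li; apply: mmin.
apply/esym/submod_eq/(dk_eq TU) => k.
have := dk_secmap k fP; rewrite (dk_tr k Gj Gup) (dk_tr k G'j G'up) (dk_D hA).
by rewrite (big_setD1 i mG) /=; lia.
Qed.

(** * Standard filtrations of quotients of [P(j)] *)

Lemma trace_up_set j : tr j (up_set j) = fullv :> {vspace P j}.
Proof.
have [TG _] := trace_submodP (P j) (up_set j).
apply: eq_fullv => x; have [a ->] := genP x; apply: submod_stable.
by rewrite -gen_idem TG // inE.
Qed.

(** The recursion reaches the top term first, whose preimage is U([up_set j]) = P(j). Each layer is
    then pulled back along [f] and [layer_inv] removes one vertex from G. *)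
Lemma chain_down j M (f : 'Hom(P j, M)) (fh : is_hom f) (U : submod M) Us :
    limg f = fullv -> chain (@is_Delta _ _ _ _ A) U Us ->
    last U Us = fullv :> {vspace M} ->
  exists G, [/\ G \subset up_set j, upset G
    & (f @^-1: U)%VS = tr j G :> {vspace P j}].
Proof.
move=> fs; elim: Us U => [|W Us IH] U.
  move=> _ /= Uf; exists (up_set j); split=> //; first exact: up_set_upset.
  by rewrite trace_up_set Uf; apply: eq_fullv => x; rewrite -memv_preim memvf.
move=> /chain_cons[UW [i]]; rewrite -DE => /(iso_sectionP _ UW)[g gP] ch l.
have [G [Gj Gup EG]] := IH W ch l.
have gfP := secmap_preim fh (_ : (W <= limg f)%VS) gP.
have {}gfP := gfP (eq_ind_r (fun V => (W <= V)%VS) (subvf W) fs).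
rewrite EG in gfP.
have UG : (preim_submod U fh <= tr j G)%VS := secmap_sub gfP.
have iG : iso (section (tr j G) (preim_submod U fh)) (D i).
  by apply/iso_sectionP => //; exists (g \o f)%VF.
have [iG' G'up E] := layer_inv Gj Gup UG iG.
exists (G :\ i); split=> //; first by apply: subset_trans Gj; apply: subsetDl.
by rewrite -E.
Qed.

Lemma chain_up j M (f : 'Hom(P j, M)) (fh : is_hom f) G G' :
    G \subset G' -> G' \subset up_set j -> upset G -> upset G' ->
    (lker f <= tr j G)%VS ->
  exists2 Us, chain (@is_Delta _ _ _ _ A) (img_submod (is_hom_on (W := tr j G) fh)) Us
    & last (img_submod (is_hom_on (W := tr j G) fh)) Us = (f @: tr j G')%VS :> {vspace M}.
Proof.
have [b] := ubnP #|G' :\: G|; elim: b G => // b IH G Gb GG' G'j Gup G'up fG.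
have [E|[x0 x0G]] := set_0Vmem (G' :\: G).
  exists [::] => //=; congr (_ @: (tr j _))%VS; apply/eqP.
  by rewrite eqEsubset GG' -setD_eq0 E eqxx.
(* Adding a maximal element of the difference keeps G up-closed, so [layer_Delta] applies to the new
   layer. *)
have [x xG xmax] := exists_maximal x0G.
have [xG' xnG] : x \in G' /\ x \notin G by move: xG; rewrite inE => /andP[].
pose G1 := x |: G.
have G1up : upset G1.
  move=> a c; rewrite !inE => /orP[/eqP->|aG] ac; last by rewrite (Gup a c) ?orbT.
  case: (boolP (c \in G)) => cG; rewrite ?orbT // orbF.
  by apply/eqP/xmax; rewrite // inE cG (G'up x).
have G1D : G1 :\ x = G.
  by apply/setP => a; rewrite !inE; case: eqVneq => [->|//]; rewrite (negbTE xnG).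
have G1G' : G1 \subset G' by rewrite subUset sub1set xG'.
have GG1 : G \subset G1 by apply: subsetUr.
have G1j := subset_trans G1G' G'j.
have xG1 : x \in G1 by apply: setU11.
have sub1 := trace_subset (P j) GG1.
have [|Us ch la] := IH G1 _ G1G' G'j G1up G'up (subv_trans fG sub1).
  rewrite -ltnS; apply: leq_trans Gb; rewrite ltnS; apply: proper_card.
  apply/properP; split; first exact: setDS.
  by exists x; rewrite ?xG // inE xG1.
exists (img_submod (is_hom_on (W := tr j G1) fh) :: Us) => //.
have GGi : (img_submod (is_hom_on (W := tr j G) fh) <=
    img_submod (is_hom_on (W := tr j G1) fh))%VS by apply: limgS.
apply/chain_cons; split=> //; exists x; rewrite -DE; apply/iso_sectionP => //.
have := layer_Delta G1j G1up xG1; rewrite G1D => /(_ Gup) /(iso_sectionP _ sub1)[g gP].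
apply: (secmap_img (is_hom_on (W := tr j G1) fh) _ _ gP); first exact: submod_stable.
by apply: subv_trans fG; apply: capvSr.
Qed.

(** Bridges the arbitrary subsets of the theorem and the up-closed sets of the proof: both the sum
    of the P(i) and the intersection of the K(i) over [L] depend only on this closure. *)
Definition up_closure (L : {set Q0}) : {set Q0} :=
  [set l | [exists i in L, (i <= l)%O]].

Lemma up_closure_upset L : upset (up_closure L).
Proof.
move=> a c; rewrite !inE => /exists_inP[i iL ia] ac; apply/exists_inP.
by exists i => //; apply: le_trans ia ac.
Qed.

Lemma up_closure_sub j L : L \subset up_set j -> up_closure L \subset up_set j.
Proof.
move=> /subsetP Lj; apply/subsetP => l; rewrite !inE => /exists_inP[i /Lj].
by rewrite inE; apply: le_trans.
Qed.

Lemma upset_closure G : upset G -> up_closure G = G.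
Proof.
move=> Gup; apply/setP => l; rewrite inE; apply/exists_inP/idP => [[i iG]|lG].
  exact: Gup.
by exists l.
Qed.

Local Notation Pin j i :=
  (the (zero_submod (P j)) (fun U => iso (sub_mod U) (P i))).

Lemma sum_P_in j L : L \subset up_set j ->
  sum_submod L (fun i => Pin j i) = tr j (up_closure L) :> {vspace P j}.
Proof.
move=> Lj; have [TG TGm] := trace_submodP (P j) (up_closure L).
have jL i : i \in L -> (j <= i)%O by move=> /(subsetP Lj); rewrite inE.
apply/eqP; rewrite eqEsubv; apply/andP; split.
  apply/subv_sumP => i iL; rewrite (P_inE hA (jL i iL)).
  have [_ Tm] := trace_submodP (P j) [set i]; apply: Tm => l; rewrite inE => /eqP->.
  by apply: TG; rewrite inE; apply/exists_inP; exists i.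
apply: TGm => l; rewrite inE => /exists_inP[i iL il] v.
have := trace_up hA (jL i iL) il v; rewrite -(P_inE hA (jL i iL)).
by apply/subvP/(sumv_sup i iL).
Qed.

Lemma F_Delta_quotient j M : iso (top M) (Smod A j) ->
  F_Delta M <-> exists L : {set Q0}, L \subset up_set j :\ j /\
    iso M (quo_mod (sum_submod L (fun i => Pin j i))).
Proof.
move=> tM; split=> [[Us /filtration_byE[ch l]]|[L [LJ ML]]].
  have [f fh fs] := top_gen_sealed tM; have [G [Gj Gup EG]] := chain_down fh fs ch l.
  rewrite lpreim0 in EG.
  exists G; split.
    (* If j were in G, then G would be all of [up_set j] and M would be zero, against its simple
       top. *)
    apply/subsetP => i iG; rewrite inE (subsetP Gj) // andbT inE.
    apply/eqP => ij; subst i.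
    have M0 : (fullv : {vspace M}) = 0%VS.
      have GE : G = up_set j.
        by apply/eqP; rewrite eqEsubset Gj; apply/subsetP => a; rewrite inE; apply: Gup.
      by rewrite -fs; apply/eqP; rewrite -lkerE EG GE trace_up_set.
    have := dk_quo_mod j (Defs.rad M); rewrite {1}M0 dk0 => /esym/eqP.
    rewrite addn_eq0 => /andP[_]; rewrite (dk_iso j tM) dk_simple ?asboolT //.
      exact: iso_refl.
    exact: Smod_simple.
  apply: iso_sym; apply/iso_quoP; exists f; split=> //.
  rewrite capfv EG sum_P_in ?upset_closure //.
have Lj : L \subset up_set j by apply: subset_trans LJ _; apply: subsetDl.
have /iso_quoP[f fP] := iso_sym ML.
have fh : is_hom f by move=> a v; rewrite (secmap_hom fP) ?memvf.
have fk : lker f = tr j (up_closure L) :> {vspace P j}.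
  by rewrite -(sum_P_in Lj); case: fP; rewrite capfv.
have [|Us ch l] := chain_up fh (up_closure_sub Lj) (subxx _) (@up_closure_upset L)
  (@up_set_upset _ Q0 j); first by rewrite fk.
exists Us; apply/filtration_byE.
have E0 : img_submod (is_hom_on (W := tr j (up_closure L)) fh) = zero_submod M.
  by apply: submod_eq => /=; rewrite -fk; apply/eqP; rewrite -lkerE.
rewrite E0 in ch l; split=> //; rewrite l trace_up_set; by case: fP.
Qed.

End Layers.

(** * Submodules of I(j) filtered by costandard modules *)

Section Colayers.
Variables (K : closedFieldType) (d : Order.disp_t) (Q0 : finPOrderType d).
Variables (Q : quiver Q0) (A : bound_quiver_algebra K Q).
Implicit Types (i j k l m : Q0) (M N X Y : fdmod A) (G L : {set Q0}).

Local Notation e := (vertex_idem A).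
Local Notation D := (sval (Delta_sealed A)).
Local Notation P := (sval (Pmod_sealed A)).
Local Notation I := (sval (Imod_sealed A)).
Local Notation Nb := (sval (Nabla_sealed A)).
Local Notation gen := (sval (gen_sealed A)).
Local Notation dimk k M := (dk k (fullv : {vspace M})).
Variables (o n : Q0) (hA : one_quasi_hereditary A o n).

Lemma Imod_ev m : exists ev : 'Hom(I m, K^o),
  (forall phi, (forall a, ev (act a phi) = 0) -> phi = 0) /\
  (forall phi, ev (act (e m) phi) = ev phi).
Proof.
rewrite (svalP (Imod_sealed A)); exists (Iev A m); split=> phi; first exact: Iev_eq0.
exact: Iev_idem.
Qed.

Lemma Imod_idem_sealed m (phi : I m) :
  (forall a, act (e m) (act a phi) = 0) -> phi = 0.
Proof.
by have [ev [ev0 eve]] := Imod_ev m => H; apply: ev0 => a; rewrite -eve H linear0.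
Qed.

Lemma dk_Imod_ge_sealed j k : (dimk j (P k) <= dimk k (I j))%N.
Proof.
by rewrite (svalP (Imod_sealed A)) (svalP (Pmod_sealed A)); apply: dk_Imod_ge.
Qed.

Lemma Nabla_submod m : exists C : submod (I m), [/\ iso (sub_mod C) (Nb m),
  (forall k, ~~ (k <= m)%O -> forall v, v \in (C : {vspace I m}) -> act (e k) v = 0) &
  forall U : submod (I m),
    (forall k, ~~ (k <= m)%O -> forall v, v \in (U : {vspace I m}) -> act (e k) v = 0) ->
    (U <= C)%VS].
Proof.
rewrite (svalP (Imod_sealed A)) (svalP (Nabla_sealed A)).
have [C1 C2] := costandard_submodP A m.
by exists (costandard_submod A m); split=> //; apply: iso_refl.
Qed.

(** The hypotheses on [ev] describe a submodule of I(m). An element phi of e_k X gives a map P(k) ->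
    X killing T = U({l | l > m}), and phi is determined by the values of [ev] on the image of e_m
    P(k). By the lower bound on T, e_m P(k) has dimension at most [k <= m] modulo T, so at most one
    number determines phi. *)
Lemma dk_coideal k m X (ev : 'Hom(X, K^o)) :
    (forall phi, (forall a, ev (act a phi) = 0) -> phi = 0) ->
    (forall phi, ev (act (e m) phi) = ev phi) ->
    (forall l, (m < l)%O -> forall v : X, act (e l) v = 0) ->
  (dimk k X <= (k <= m)%O)%N.
Proof.
move=> ev0 eve X0; pose S := [set l : Q0 | (m < l)%O].
have [TS Tmin] := trace_submodP (P k) S; set T := trace_submod (P k) S in TS Tmin.
pose U := limg (actf (P k) (e m)); pose V := (actf (P k) (e m) @: T)%VS.
have VU : (V <= U)%VS by apply/limgS/subvf.
have dUV : (\dim (U :\: V) <= (k <= m)%O)%N.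
  have := dimv_cap_compl U V; rewrite (capv_idPr VU).
  have := dk_trace_sealed hA m k S; rewrite /dk -/U -/T -/V.
  have : (\sum_(l in up_set k :\: S) (m <= l)%O <= (k <= m)%O)%N.
    case: (boolP (m \in up_set k :\: S)) => mS.
      rewrite (big_setD1 m mS) /= big1 ?addn0 => [|l].
        by move: mS; rewrite !inE lexx => /andP[_ ->].
      rewrite !inE => /and3P[lm nml _]; apply/eqP; rewrite eqb0.
      by apply: contra nml => ml; rewrite lt_neqAle eq_sym lm.
    rewrite big1 // => l; rewrite !inE => /andP[nml kl]; apply/eqP; rewrite eqb0.
    apply: contra mS => ml; move: nml; rewrite lt_neqAle ml andbT negbK => /eqP El.
    by rewrite !inE ltxx El kl.
  lia.
(* A vector spanning the complement of e_m T in e_m P(k), of dimension at most 1. If the complement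
   is zero, [vpick] returns 0, which settles the case where k is not <= m. *)
pose b := vpick (U :\: V)%VS; have [beta bE] := genP b.
have bP v : exists c, act (e m) v - c *: b \in (T : {vspace P k}).
  have vU : act (e m) v \in U by rewrite -actfE memv_img ?memvf.
  move: vU; rewrite -(addv_diff_cap U V) => /memv_addP[x xD [y yV ->]].
  have : (U :\: V <= <[b]>)%VS.
    case: (boolP ((U :\: V)%VS == 0%VS)) => [/eqP->|D0]; first exact: sub0v.
    have bD : (<[b]> <= U :\: V)%VS by rewrite -memvE memv_pick.
    have /eqP-> // : (<[b]> == U :\: V)%VS.
    rewrite eqEdim bD dim_vline vpick0 D0; apply: leq_trans dUV _.
    by case: (_ <= _)%O.
  move=> /subvP/(_ x xD)/vlineP[c ->]; exists c => //.
  rewrite addrAC subrr add0r; move: yV; rewrite memv_cap => /andP[_].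
  exact: (subvP (comp_sub m T)).
have dimF : (dimk k X <= \dim ((ev \o actf X beta) @: limg (actf X (e k))))%N.
  rewrite limg_dim_eq // ; apply/eqP; rewrite -subv0; apply/subvP => phi.
  rewrite memv_cap memv_ker comp_lfunE actfE (compP _ (full_submod X)) memv0.
  move=> /andP[/andP[_ /eqP ephi] /eqP evb]; apply/eqP/ev0 => a.
  have [h hh hg] := gen_map ephi.
  have hT : (T <= preim_submod (zero_submod X) hh)%VS.
    apply: Tmin => l; rewrite inE => ml v; rewrite -memv_preim hh X0 // mem0v //.
  have [c cT] := bP (act a (gen k)).
  have := subvP hT _ cT; rewrite -memv_preim memv0 linearB /= linearZ /= bE !hh hg.
  by rewrite -eve subr_eq0 => /eqP->; rewrite linearZ /= evb scaler0.
have [km|km] := boolP (k <= m)%O.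
  by apply: leq_trans dimF _; apply: leq_trans (dimvS (subvf _)) _; rewrite dimvf.
move: dUV; rewrite (negbTE km) leqn0 dimv_eq0 => /eqP D0.
have b0 : b = 0 by apply/eqP; rewrite /b D0 vpick0.
apply: leq_trans dimF _; rewrite leqn0 dimv_eq0 -subv0.
apply/subvP => _ /memv_imgP[phi phiE ->].
move: phiE; rewrite (compP _ (full_submod X)) => /andP[_ /eqP ephi].
have [h hh hg] := gen_map ephi.
by rewrite comp_lfunE actfE -hg -hh -bE b0 !linear0 mem0v.
Qed.

(* The largest submodule of M without composition factors S(l), l in G. *)
Definition annih_submod M G : submod M := largest_submod (fun U =>
  forall l, l \in G -> forall v, v \in (U : {vspace M}) -> act (e l) v = 0).

Lemma annih_submodP M G :
  (forall l, l \in G -> forall v, v \in (annih_submod M G : {vspace M}) -> act (e l) v = 0)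
  /\ forall U : submod M, (forall l, l \in G -> forall v, v \in (U : {vspace M}) ->
    act (e l) v = 0) -> (U <= annih_submod M G)%VS.
Proof.
apply: (largest_submodP (P := fun U : submod M =>
    forall l, l \in G -> forall v, v \in (U : {vspace M}) -> act (e l) v = 0)).
  by move=> l _ v; rewrite memv0 => /eqP->; apply: act0.
move=> U W Z UP WP UW l lG v; rewrite -UW => /memv_addP[u uU [w wW ->]].
by rewrite actD UP // WP // addr0.
Qed.

(** * The submodules [V(G)] of [P(o)] and their layers *)

Local Notation V G := (annih_submod (P o) G).

Lemma annih_subset M G L : L \subset G -> (annih_submod M G <= annih_submod M L)%VS.
Proof.
move=> /subsetP LG; have [GP _] := annih_submodP M G; have [_ Lm] := annih_submodP M L.
by apply: Lm => l lL v; apply/GP/LG.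
Qed.

Lemma annihP M G (v : M) : (v \in (annih_submod M G : {vspace M})) <->
  forall l, l \in G -> v \in (annih_submod M [set l] : {vspace M}).
Proof.
split=> [vG l lG|H].
  by apply: (subvP (annih_subset _ _)) vG; rewrite sub1set.
have [_ Gm] := annih_submodP M G.
apply: (subvP (Gm (cap_submod G (fun l => annih_submod M [set l])) _)).
  move=> l lG w wC; have [lP _] := annih_submodP M [set l]; apply: (lP l (set11 l)).
  by move: wC; rewrite memvE => /subv_bigcapP/(_ l lG).
by rewrite memvE; apply/subv_bigcapP => l lG; rewrite -memvE; apply: H.
Qed.

(** For i >= j, dim e_i I(j) >= dim e_j P(i) = dim e_i P(j) = dim e_i P(o), so e_i kills the kernel.
    Conversely, if e_j annihilates all multiples of v, then g(v) = 0, as evaluation on I(j) only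
    sees e_j-parts. *)
Lemma ker_to_Imod j (g : 'Hom(P o, I j)) : is_hom g -> limg g = fullv ->
  lker g = V (up_set j).
Proof.
move=> gh gs; have kst : stable (lker g).
  by move=> a v; rewrite !memv_ker gh => /eqP->; rewrite act0.
have [VP Vm] := annih_submodP (P o) (up_set j).
apply/eqP; rewrite eqEsubv; apply/andP; split.
  apply: (Vm (SubMod kst)) => i; rewrite inE => ji v vk.
  apply: (@dk_eq0 _ _ _ _ _ i _ (SubMod kst)) => //=.
  have gS : secmap (full_submod (P o)) (SubMod kst) g.
    by split; [apply: is_hom_on | | rewrite /= capfv].
  have := dk_secmap i gS; have := dk_Imod_ge_sealed j i.
  have := dk_Pmod_up hA ji; have := dk_Pmod_up hA (le_o hA i).
  have := dk_PmodC hA i j; rewrite /=; lia.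
apply/subvP => v vV; rewrite memv_ker; apply/eqP/Imod_idem_sealed => a.
rewrite -!gh VP ?linear0 ?inE //; exact: submod_stable.
Qed.

Lemma Imod_cover j : exists2 g : 'Hom(P o, I j), is_hom g & limg g = fullv.
Proof. exact: (top_gen_sealed (top_I hA j)). Qed.

Lemma annih_up j : V [set j] = V (up_set j) :> {vspace P o}.
Proof.
have [g gh gs] := Imod_cover j; apply/eqP; rewrite eqEsubv; apply/andP; split; last first.
  by apply: annih_subset; rewrite sub1set inE.
rewrite -(ker_to_Imod gh gs); apply/subvP => v vV.
have [VP _] := annih_submodP (P o) [set j].
rewrite memv_ker; apply/eqP/Imod_idem_sealed => a.
rewrite -!gh VP ?linear0 ?set11 //; exact: submod_stable.
Qed.

Lemma secmap_onto_img M N (W : submod M) (f : 'Hom(M, N)) (fh : hom_on W f) :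
  exists f' : 'Hom(M, sub_mod (img_submod fh)), secmap W (W :&: lker f)%VS f'.
Proof.
exists (linfun (vsproj (img_submod fh)) \o f)%VF.
have fE v : v \in (W : {vspace M}) ->
    vsval ((linfun (vsproj (img_submod fh)) \o f)%VF v) = f v.
  by move=> vW; rewrite comp_lfunE lfunE /= vsprojK // memv_img.
apply: secmapP => [|a v vW|x|w wW]; first exact: capvSl.
- by apply: subvs_inj; rewrite sub_actE !fE ?fh // submod_stable.
- have /memv_imgP[w wW wx] := subvsP x.
  by exists w => //; apply: subvs_inj; rewrite fE.
rewrite memv_cap wW memv_ker -fE //=; split=> [->|/eqP f0]; first by rewrite linear0.
by apply: subvs_inj; rewrite f0.
Qed.

Lemma dk_sub_Imod k m (U : submod (I m)) :
  (forall l, (m < l)%O -> forall v, v \in (U : {vspace I m}) -> act (e l) v = 0) ->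
  (dk k U <= (k <= m)%O)%N.
Proof.
move=> U0; have [ev [ev0 eve]] := Imod_ev m; rewrite -dk_sub_mod.
pose evU := (ev \o linfun vsval)%VF : 'Hom(sub_mod U, K^o).
have evE x : evU x = ev (vsval x) by rewrite comp_lfunE lfunE.
apply: (@dk_coideal k m _ evU) => [phi H|phi|l ml v].
- by apply/subvs_inj/ev0 => a; rewrite -(H a) evE sub_actE.
- by rewrite !evE sub_actE eve.
by apply: subvs_inj; rewrite sub_actE U0 // subvsP.
Qed.

Lemma annihD1 G m : m \in G ->
  (V (G :\ m) :&: V [set m] = V G)%VS.
Proof.
move=> mG; apply/vspaceP => v; rewrite memv_cap; apply/andP/idP => [[v1 v2]|vG].
  apply/annihP => l lG; have [->//|lm] := eqVneq l m.
  by move/annihP: v1; apply; rewrite !inE lm.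
by split; apply: (subvP (annih_subset _ _)) vG; rewrite ?subsetDl ?sub1set.
Qed.

(** The kernel of P(o) ->> I(m) is V({m}), and V(G - m) meets it in V(G). So the layer is the image
    of V(G - m) in I(m). *)
Lemma colayer_img G m : upset G -> m \in G -> exists Y : submod (I m),
  [/\ iso (section (V (G :\ m)) (V G)) (sub_mod Y),
     forall l, l \in G :\ m -> forall v, v \in (Y : {vspace I m}) -> act (e l) v = 0
   & forall k, dk k (V (G :\ m)) = (dk k (V G) + dk k Y)%N].
Proof.
move=> Gup mG; have [g gh gs] := Imod_cover m.
have ghV : hom_on (V (G :\ m)) g by apply: is_hom_on.
have [f fP] := secmap_onto_img ghV.
rewrite (ker_to_Imod gh gs) -annih_up annihD1 // in fP.
exists (img_submod ghV); split.
- by apply/iso_sectionP; [apply: annih_subset; apply: subsetDl | exists f].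
- have [VP _] := annih_submodP (P o) (G :\ m).
  by move=> l lG v /memv_imgP[w wV ->]; rewrite -gh VP // linear0.
by move=> k; rewrite (dk_secmap k fP) dk_sub_mod.
Qed.

Lemma annih_step G m k : upset G -> m \in G ->
  (dk k (V (G :\ m)) <= dk k (V G) + (k <= m)%O)%N.
Proof.
move=> Gup mG; have [Y [_ Y0 ->]] := colayer_img Gup mG.
rewrite leq_add2l; apply: dk_sub_Imod => l ml; apply: Y0.
by rewrite !inE (gt_eqF ml) (Gup m) // ltW.
Qed.

Lemma annih_ge k G : upset G ->
  (dimk k (P o) <= dk k (V G) + \sum_(l in G) (k <= l)%O)%N.
Proof.
have [b] := ubnP #|G|; elim: b G => // b IH G Gb Gup.
have [G0|[m0 m0G]] := set_0Vmem G.
  apply: leq_trans (leq_addr _ _); apply: dkS.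
  by have [_ Vm] := annih_submodP (P o) G; apply: (Vm (full_submod _)) => l; rewrite G0 inE.
have [m [mG _] mmin] := exists_minimal m0G.
have G'up := upsetD1 Gup mmin.
have G'b : (#|G :\ m| < b)%N by move: Gb; rewrite (cardsD1 m) mG ltnS.
apply: leq_trans (IH _ G'b G'up) _; rewrite [X in (_ <= _ + X)%N](big_setD1 m) //=.
by rewrite addnA leq_add2r annih_step.
Qed.

(** The same one-step bound as in [annih_ge], now used between G and Q0, where V(Q0) = 0: maximal
    elements of the complement are added to G. Both estimates together leave no slack. *)
Lemma annih_le k G : upset G -> (dk k (V G) <= \sum_(l in ~: G) (k <= l)%O)%N.
Proof.
have [b] := ubnP #|~: G|; elim: b G => // b IH G Gb Gup.
have [G0|[x0 x0G]] := set_0Vmem (~: G).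
  rewrite dk_eq0P // => v vV; have [VP _] := annih_submodP (P o) G.
  by apply: VP => //; have := in_set0 k; rewrite -G0 inE => /negbFE.
have [x xG xmax] := exists_maximal x0G.
have xnG : x \notin G by move: xG; rewrite inE.
have G1up : upset (x |: G).
  move=> a c; rewrite !inE => /orP[/eqP->|aG] ac; last by rewrite (Gup a c) ?orbT.
  case: (boolP (c \in G)) => cG; rewrite ?orbT // orbF.
  by apply/eqP/xmax; rewrite // inE cG.
have G1D : (x |: G) :\ x = G.
  by apply/setP => a; rewrite !inE; case: eqVneq => [->|//]; rewrite (negbTE xnG).
have CG1 : ~: (x |: G) = (~: G) :\ x.
  by apply/setP => a; rewrite !inE negb_or.
have := annih_step k G1up (setU11 x G); rewrite G1D => step.
apply: leq_trans step _; rewrite (big_setD1 x) //= addnC leq_add2l -CG1.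
by apply: IH => //; rewrite CG1; move: Gb; rewrite (cardsD1 x) xG ltnS.
Qed.

Lemma dk_annih k G : upset G -> dk k (V G) = (\sum_(l in ~: G) (k <= l)%O)%N.
Proof.
move=> Gup; apply/eqP; rewrite eqn_leq annih_le //=.
have := annih_ge k Gup; rewrite (dk_PmodE hA) (bigID (mem G)) /=.
have -> : (\sum_(l in G) (o <= l)%O * (k <= l)%O = \sum_(l in G) (k <= l)%O)%N.
  by apply: eq_bigr => l _; rewrite (le_o hA l) mul1n.
rewrite addnC leq_add2r; apply: leq_trans; apply: eq_leq.
by apply: eq_big => [l|l _]; rewrite ?inE // (le_o hA l) mul1n.
Qed.

(** The image Y of the layer in I(m) has dimensions exactly [k <= m], so it lies in the costandard
    submodule, whose dimensions [dk_sub_Imod] bounds by the same numbers. The dimensions of nabla(m)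
    come out as a by-product. *)
Lemma colayer_Nabla G m : upset G -> m \in G -> upset (G :\ m) ->
  iso (section (V (G :\ m)) (V G)) (Nb m) /\ forall k, dimk k (Nb m) = (k <= m)%O.
Proof.
move=> Gup mG G'up; have [Y [YI Y0 dY]] := colayer_img Gup mG.
have [C [CI C0 Cm]] := Nabla_submod m.
have Ym l : (m < l)%O -> l \in G :\ m.
  by move=> ml; rewrite !inE (gt_eqF ml) (Gup m) // ltW.
have dkY k : dk k Y = (k <= m)%O.
  have := dY k; rewrite !dk_annih //.
  have -> : ~: (G :\ m) = m |: ~: G.
    by apply/setP => a; rewrite !inE negb_and negbK.
  rewrite big_setU1 ?inE ?mG //=; lia.
have YC : Y = C :> {vspace I m}.
  apply: dk_eq => [|k].
    apply: Cm => k km v vY; apply: (dk_eq0 _ vY).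
    by rewrite dkY (negbTE km).
  rewrite dkY; apply: dk_sub_Imod => l ml; apply: C0.
  by apply/negP => lm; have := le_lt_trans lm ml; rewrite ltxx.
have YC' := submod_eq YC; subst Y; split; first exact: iso_trans YI CI.
by move=> k; rewrite -(dk_iso k CI) dk_sub_mod.
Qed.

Lemma dk_Nb k m : dimk k (Nb m) = (k <= m)%O.
Proof.
have mm : m \in up_set m by rewrite inE.
apply: (colayer_Nabla (@up_set_upset _ Q0 m) mm _).2.
by apply: upsetD1 => [|b]; [apply: up_set_upset | rewrite inE => mb bm; apply/eqP; rewrite eq_le bm mb].
Qed.

Lemma Nb_idem m (phi : Nb m) :
  (forall a, act (e m) (act a phi) = 0) -> phi = 0.
Proof.
have [C [CI _ _]] := Nabla_submod m; have /isoP[f fP] := iso_sym CI => H.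
apply/eqP; rewrite -memv0 -(secmap_ker fP) ?memvf //; apply/eqP/subvs_inj.
have vE b (x : sub_mod C) : vsval (act b x) = act b (vsval x) by apply: sub_actE.
rewrite linear0; apply: Imod_idem_sealed => a.
by rewrite -!vE -!(secmap_hom fP) ?memvf // H linear0.
Qed.

(** A simple submodule has a nonzero e_m-part, since by [Nb_idem] no nonzero element has all its
    multiples killed by e_m; that part spans it. *)
Lemma Nb_socle m : exists z : Nb m, [/\ z != 0, act (e m) z = z &
  forall a, exists c, act a z = c *: z].
Proof.
have N0 : full_submod (Nb m) <> 0%VS :> {vspace Nb m}.
  by move=> /= E; have := dk_Nb m m; rewrite E dk0 lexx.
have [Z _ Zs] := exists_simple_sub N0; have /simple_sub[Z0 _] := Zs.
have [[phi phiZ phi0]|phi0] := pselect (exists2 phi, phi \in (Z : {vspace Nb m}) & phi != 0).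
  have [a za] : exists a, act (e m) (act a phi) != 0.
    apply: contrapT => H; case/eqP: phi0; apply: Nb_idem => a.
    by apply/eqP; apply: contraT => za; case: H; exists a.
  set z := act (e m) _ in za.
  have zZ : z \in (Z : {vspace Nb m}) by rewrite !submod_stable.
  exists z; split=> //; first by rewrite idem_act.
  move=> b; pose z' : sub_mod Z := vsproj Z z.
  have z'E : vsval z' = z by rewrite vsprojK.
  have ez' : act (e m) z' = z' by apply: subvs_inj; rewrite sub_actE z'E idem_act.
  have z'0 : z' != 0 by apply: contra za => /eqP z'0; rewrite -z'E z'0 linear0.
  have := memvf (act b z'); rewrite -(simple_line Zs ez' z'0) => /vlineP[c /(congr1 vsval)].
  by rewrite sub_actE linearZ /= z'E => E; exists c.
case: Z0; apply/eqP; rewrite -subv0; apply/subvP => v vZ; rewrite memv0.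
by apply: contraT => v0; case: phi0; exists v.
Qed.

Lemma colayer_inv i G (H : submod (P o)) : upset G -> (V G <= H)%VS ->
    iso (section H (V G)) (Nb i) ->
  [/\ i \in G, upset (G :\ i) & H = V (G :\ i)].
Proof.
move=> Gup GH /(iso_sectionP _ GH)[f fP]; have [VP _] := annih_submodP (P o) G.
have [z [z0 ez az]] := Nb_socle i; have [h hH fh] := secmap_surj z fP.
have hG : h \notin (V G : {vspace P o}) by rewrite -(secmap_ker fP) // fh.
(* Dual to the comparison of tops: a lift [h] of the socle vector of nabla(i) lies outside V(G),
   hence outside V({m}) for a minimal m of G, so e_m a h is nonzero for some a. *)
have [l lG hl] : exists2 l, l \in G & h \notin (V [set l] : {vspace P o}).
  apply: contrapT => H0; case/negP: hG; apply/annihP => l lG.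
  by apply: contraT => hl; case: H0; exists l.
have [m [mG ml] mmin] := exists_minimal lG.
have hm : h \notin (V [set m] : {vspace P o}).
  apply: contra hl; rewrite annih_up; apply/subvP/annih_subset.
  by rewrite sub1set inE.
have [a ha] : exists a, act (e m) (act a h) != 0.
  have [g gh gs] := Imod_cover m; apply: contrapT => H0; case/negP: hm.
  rewrite annih_up -(ker_to_Imod gh gs) memv_ker; apply/eqP/Imod_idem_sealed => a.
  rewrite -!gh; apply/eqP; rewrite -memv_ker; apply: contraT => ka; case: H0.
  by exists a; apply: contra ka => /eqP->; rewrite mem0v.
(* a h maps to a multiple of z = e_i z. If m differs from i, then e_m a h lies in V(G), on which e_m
   vanishes. *)
have mi : m = i.
  apply/eqP; apply: contraNT ha => mi; have [c cz] := az a.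
  have : act (e m) (act a h) \in (V G : {vspace P o}).
    rewrite -(secmap_ker fP) ?submod_stable // !(secmap_hom fP) ?submod_stable // fh cz.
    by rewrite linearZ /= -ez -actM idemM (negbTE mi) act0l scaler0.
  by move=> /(VP m mG); rewrite idem_act => ->.
subst m; have G'up := upsetD1 Gup mmin; split=> //.
have [_ Vm] := annih_submodP (P o) (G :\ i).
have HV : (H <= V (G :\ i))%VS.
  apply: Vm => l'; rewrite !inE => /andP[li l'G] v vH; rewrite -idem_act; apply: (VP l' l'G).
  rewrite -(secmap_ker fP) ?submod_stable // (secmap_hom fP) //; apply/eqP.
  apply: (@dk_eq0 _ _ _ _ _ l' _ (full_submod (Nb i))); rewrite ?memvf //=.
  rewrite dk_Nb; case: (boolP (l' <= i)%O) => // le_li.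
  by case/eqP: li; apply: mmin.
apply/submod_eq/(dk_eq HV) => k.
have := dk_secmap k fP; rewrite dk_Nb !dk_annih // => ->.
have -> : ~: (G :\ i) = i |: ~: G by apply/setP => b; rewrite !inE negb_and negbK.
by rewrite big_setU1 ?inE ?mG //= addnC.
Qed.

(** * Costandard filtrations of modules with socle [S(j)] *)

Local Notation Kin j := (the (zero_submod (P o)) (fun U =>
    exists (f : 'Hom(P o, I o)) (g : 'Hom(I o, I j)),
      [/\ injective_hom f, surjective_hom f, surjective_hom g
        & U = lker (g \o f)%VF :> {vspace P o}])).

Lemma ker_to_IE j : Kin j = V (up_set j).
Proof.
set R := fun U : submod (P o) => _.
have RV U : R U -> U = V (up_set j).
  move=> [f [g [[fh f0] [_ fs] [gh gs] UE]]]; apply: submod_eq; rewrite UE.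
  apply: ker_to_Imod; first by move=> a v; rewrite !comp_lfunE fh gh.
  by rewrite limg_comp fs gs.
apply: RV; apply: (@the_spec _ _ R); have [f [fh f0 fs]] := Pmod_Imod hA; have [g gh gs] := Imod_cover j.
have fI : injective f by apply/lker0P/eqP.
have fK : cancel (f^-1)%VF f by move=> x; rewrite limg_lfunVK // fs memvf.
have fK' : cancel f (f^-1)%VF by move=> x; apply: fI; rewrite fK.
exists (V (up_set j)), f, (g \o f^-1)%VF; split=> //.
  split; first by move=> a v; rewrite !comp_lfunE -gh; congr (g _); apply: fI; rewrite fh !fK.
  apply: eq_fullv => y; have := memvf y; rewrite -gs => /memv_imgP[x _ ->].
  by apply/memv_imgP; exists (f x); rewrite ?memvf // comp_lfunE fK'.
rewrite -(ker_to_Imod gh gs); apply/vspaceP => x; rewrite !memv_ker !comp_lfunE fK' //.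
Qed.

Lemma cap_ker_to_I L : cap_submod L (fun i => Kin i) = V (up_closure L).
Proof.
apply: submod_eq; apply/vspaceP => v; apply/idP/idP => [|/annihP].
  rewrite memvE => /subv_bigcapP H; apply/annihP => l; rewrite inE => /exists_inP[i iL il].
  have := H i iL; rewrite ker_to_IE -memvE; apply/subvP/annih_subset.
  by rewrite sub1set inE.
move=> H; rewrite memvE; apply/subv_bigcapP => i iL; rewrite -memvE ker_to_IE.
rewrite -annih_up; apply: H; rewrite inE; apply/exists_inP; by exists i.
Qed.

(** N is embedded into I(j) and its chain is pulled back to P(o). The walk goes upwards from ker pi,
    and each layer removes one vertex from G by [colayer_inv]. *)
Lemma cochain_up j N (psi : 'Hom(N, I j)) (pi : 'Hom(P o, I j))
    (psih : is_hom psi) (pih : is_hom pi) (U : submod N) Us G :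
    lker psi = 0%VS -> limg pi = fullv ->
    chain (@is_Nabla _ _ _ _ A) U Us -> G \subset up_set j -> upset G ->
    (pi @^-1: (psi @: U))%VS = V G :> {vspace P o} ->
  exists G', [/\ G' \subset up_set j, upset G'
    & (pi @^-1: (psi @: (last U Us)))%VS = V G' :> {vspace P o}].
Proof.
move=> psi0 pis; elim: Us U G => [|W Us IH] U G; first by move=> _ Gj Gup E; exists G.
move=> /chain_cons[UW [i]]; rewrite -(svalP (Nabla_sealed A)).
move=> /(iso_sectionP _ UW)[g gP] ch Gj Gup EG.
have psihW : hom_on W psi by apply: is_hom_on.
have [||g' gP'] := secmap_img psihW _ _ gP; first exact: submod_stable.
  by rewrite psi0 capv0 sub0v.
have gP2 := secmap_preim pih (eq_ind_r (fun Z => (psi @: W <= Z)%VS) (subvf _) pis) gP'.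
rewrite EG in gP2.
have GH : (V G <= preim_submod (img_submod psihW) pih)%VS := secmap_sub gP2.
have iH : iso (section (preim_submod (img_submod psihW) pih) (V G)) (Nb i).
  by apply/iso_sectionP => //; exists (g' \o pi)%VF.
have [iG G'up E] := colayer_inv Gup GH iH.
apply: (IH W (G :\ i) ch _ G'up); last by rewrite -E.
by apply: subset_trans Gj; apply: subsetDl.
Qed.

Lemma cochain_down N (f : 'Hom(P o, N)) G0 G G1 (fh : hom_on (V G0) f)
    (fhG : hom_on (V G) f) :
    G0 \subset G -> G \subset G1 -> upset G0 -> upset G ->
    (V G0 :&: lker f <= V G1)%VS ->
  exists2 Us, chain (@is_Nabla _ _ _ _ A) (img_submod fhG) Us
    & last (img_submod fhG) Us = (f @: V G0)%VS :> {vspace N}.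
Proof.
have [b] := ubnP #|G :\: G0|; elim: b G fhG => // b IH G fhG Gb G0G GG1 G0up Gup fG.
have [E|[m0 m0G]] := set_0Vmem (G :\: G0).
  exists [::] => //=; congr (_ @: V _)%VS; apply/eqP.
  by rewrite eqEsubset G0G -setD_eq0 E eqxx.
have [m [mGG _] mmin] := exists_minimal m0G.
have [mG mnG0] : m \in G /\ m \notin G0 by move: mGG; rewrite inE => /andP[].
(* Elements of G below m cannot lie in G0, which is up-closed and misses m; so minimality in the
   difference is minimality in G. *)
have G'up : upset (G :\ m).
  apply: upsetD1 => // c cG cm; apply: mmin => //; rewrite inE cG andbT.
  by apply: contra mnG0 => cG0; apply: G0up cm.
have G0G' : G0 \subset G :\ m.
  by apply/subsetP => a aG0; rewrite !inE (subsetP G0G) // andbT; apply: contraNneq mnG0 => <-.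
have G'G : G :\ m \subset G by apply: subsetDl.
have fhG' : hom_on (V (G :\ m)) f.
  by move=> a v vV; apply: fh; apply: (subvP (annih_subset _ G0G')).
have [|Us ch la] := IH (G :\ m) fhG' _ G0G' (subset_trans G'G GG1) G0up G'up fG.
  rewrite -ltnS; apply: leq_trans Gb; rewrite ltnS; apply: proper_card.
  apply/properP; split; first exact: setSD.
  by exists m; rewrite // !inE eqxx /= andbF.
exists (img_submod fhG' :: Us) => //.
have sub1 := annih_subset (P o) G'G.
have GGi : (img_submod fhG <= img_submod fhG')%VS by apply: limgS.
apply/chain_cons; split=> //; exists m; rewrite -(svalP (Nabla_sealed A)).
apply/iso_sectionP => //.
have [/(iso_sectionP _ sub1)[g gP] _] := colayer_Nabla Gup mG G'up.
apply: (secmap_img fhG' _ _ gP); first exact: submod_stable.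
apply: subv_trans (annih_subset _ GG1); apply: subv_trans fG.
by apply: capvS => //; apply: annih_subset.
Qed.

Lemma F_Nabla_submodule j N : iso (soc N) (Smod A j) ->
  F_Nabla N <-> exists L : {set Q0}, L \subset up_set j :\ j /\
    iso N (section (cap_submod L (fun i => Kin i)) (Kin j)).
Proof.
move=> sN; split=> [[Us /filtration_byE[ch l]]|[L [LJ NL]]].
  have [psi psih psi0] := soc_embed_sealed sN; have [pi pih pis] := Imod_cover j.
  have EJ : (pi @^-1: (psi @: zero_submod N))%VS = V (up_set j) :> {vspace P o}.
    by rewrite /= limg0 lpreim0 (ker_to_Imod pih pis).
  have [G [Gj Gup EG]] :=
    cochain_up psih pih psi0 pis ch (subxx _) (@up_set_upset _ Q0 j) EJ.
  rewrite l in EG.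
  have VG : (V (up_set j) <= V G)%VS by apply: annih_subset.
  have [||g gP] := secmap_img (is_hom_on (W := full_submod N) psih) _ _
    (secmap_id N); first exact: full_stable.
    by rewrite psi0 capv0 sub0v.
  have gP2 := secmap_preim pih (eq_ind_r (fun Z => (psi @: fullv <= Z)%VS) (subvf _) pis) gP.
  rewrite EG limg0 lpreim0 (ker_to_Imod pih pis) in gP2.
  exists G; split; last first.
    rewrite cap_ker_to_I ker_to_IE upset_closure //; apply: iso_sym.
    by apply/iso_sectionP => //; exists (g \o pi)%VF.
  apply/subsetP => i iG; rewrite inE (subsetP Gj) // andbT inE.
  apply/eqP => ij; subst i.
  have GE : G = up_set j.
    by apply/eqP; rewrite eqEsubset Gj; apply/subsetP => a; rewrite inE; apply: Gup.
  have [y [_ y0 _]] := soc_gen sN; case/eqP: y0; apply/eqP.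
  have [w wG <-] := secmap_surj y gP2.
  by rewrite (secmap_ker gP2) // -GE.
have Lj : L \subset up_set j by apply: subset_trans LJ _; apply: subsetDl.
have LJ' := up_closure_sub Lj.
have sub1 : (V (up_set j) <= V (up_closure L))%VS by apply: annih_subset.
rewrite cap_ker_to_I ker_to_IE in NL.
have /(iso_sectionP _ sub1)[f fP] := iso_sym NL.
have fh : hom_on (V (up_closure L)) f by case: fP.
have fhJ : hom_on (V (up_set j)) f by move=> a v vV; apply/fh/(subvP sub1).
have fk : (V (up_closure L) :&: lker f)%VS = V (up_set j) by case: fP.
have [|Us ch l] := @cochain_down N f _ _ (up_set j) fh fhJ LJ' (subxx _)
  (@up_closure_upset _ Q0 L) (@up_set_upset _ Q0 j); first by rewrite fk.
exists Us; apply/filtration_byE.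
(* K(j) is the kernel of f on V([up_closure L]), so the constructed chain starts at zero. *)
have E0 : img_submod fhJ = zero_submod N.
  apply: submod_eq => /=; apply/eqP; rewrite -lkerE -fk; exact: capvSr.
rewrite E0 in ch l; split=> //; rewrite l; by case: fP.
Qed.

End Colayers.

Theorem corollary4p4 (K : closedFieldType) (d : Order.disp_t)
    (Q0 : finPOrderType d) (Q : quiver Q0) (A : bound_quiver_algebra K Q)
    (o n : Q0) (hA : one_quasi_hereditary A o n)
    (j : Q0) (M N : fdmod A)
    (hM : iso (top M) (Smod A j)) (hN : iso (soc N) (Smod A j)) :
  (F_Delta M <->
     exists L : {set Q0}, L \subset up_set j :\ j /\
       iso M (quo_mod (sum_submod L (P_in A j)))) /\
  (F_Nabla N <->
     exists L : {set Q0}, L \subset up_set j :\ j /\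
       iso N (section (cap_submod L (ker_to_I A o)) (ker_to_I A o j))).
Proof.
have H1 := F_Delta_quotient hA hM; have H2 := F_Nabla_submodule hA hN.
(* The opaque copies of P and I are replaced by the originals only once everything is proved; the
   explicit [the] terms are then [P_in] and [ker_to_I] by conversion. *)
rewrite (svalP (Pmod_sealed A)) in H1 H2; rewrite (svalP (Imod_sealed A)) in H2.
exact: conj H1 H2.
Qed.
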